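(* Let $Y$ be the semimartingale defined in the context. The stopping time $S_0 := \inf\{t>0 : Y_t = 1\}$ is exponentially distributed and has mean $1$.
   Context: $(\Omega,\mathcal{F},\mathbb{P})$ is a probability space with a filtration $(\mathcal{F}_t)_{t\geq 0}$ which generates $\mathcal{F}$ and satisfies the usual conditions (right continuous, $\mathcal{F}_0$ contains all $\mathbb{P}$-null sets). Semimartingales have càdlàg paths; quadratic variations and stochastic integrals have value $0$ at time $0$. A martingale $M$ is normal if $t \mapsto (M_t-M_0)^2 - t$ is also a martingale. $X$ is the (unique in law) normal martingale with $X_0 = 0$ and $\mathrm{d}[X]_t = (1 - t - X_{t-})\,\mathrm{d}X_t + \mathrm{d}t$, i.e. $[X]_t = \int_0^t (1-s-X_{s-})\,\mathrm{d}X_s + t$ for all $t\ge 0$; and $Y_t := X_t + t$ for all $t \geq 0$. *)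

(* Defs.v *)
From HB Require Import structures.
From mathcomp Require Import all_boot all_order all_algebra.
From mathcomp Require Import all_classical all_reals all_analysis.
Import Order.TTheory GRing.Theory Num.Theory.
Import numFieldNormedType.Exports.

Set Implicit Arguments.
Unset Strict Implicit.
Unset Printing Implicit Defensive.

Local Open Scope classical_set_scope.
Local Open Scope ring_scope.

(* Time is [0, +oo[ inside R: processes and filtrations are indexed by R, and
   their values at negative times are never constrained nor used. *)

Section Processes.
Context (R : realType) (d : measure_display) (T : measurableType d).
Implicit Types (F : R -> set (set T)) (X H J K : R -> T -> R).

Definition filtration F :=
  [/\ forall t : R, 0 <= t -> sigma_algebra setT (F t),
      forall t : R, 0 <= t -> F t `<=` measurable
    & forall s t : R, 0 <= s -> s <= t -> F s `<=` F t].

Definition generates_measurable F :=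
  <<s \bigcup_(t in [set t : R | 0 <= t]) F t >> = measurable.

Definition usual_conditions (P : probability T R) F :=
  (forall t : R, 0 <= t -> F t = \bigcap_(u in [set u : R | t < u]) F u) /\
  P.-negligible `<=` F 0.

Definition measurable_wrt (G : set (set T)) (f : T -> R) :=
  forall B : set R, measurable B -> G (f @^-1` B).

Definition adapted F X := forall t : R, 0 <= t -> measurable_wrt (F t) (X t).

(* The integrands below are only relevant on ]0, +oo[. *)
Definition adapted_pos F H := forall t : R, 0 < t -> measurable_wrt (F t) (H t).

Definition cadlag X := forall w,
  (forall t : R, 0 <= t -> X s w @[s --> t^'+] --> X t w) /\
  (forall t : R, 0 < t -> cvg (X s w @[s --> t^'-])).

Definition caglad H := forall w,
  (forall t : R, 0 < t -> H s w @[s --> t^'-] --> H t w) /\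
  (forall t : R, 0 <= t -> cvg (H s w @[s --> t^'+])).

Definition left_limit X : R -> T -> R := fun t w => lim (X s w @[s --> t^'-]).

Definition stopping_time F (tau : T -> \bar R) :=
  forall t : R, 0 <= t -> F t [set w | (tau w <= t%:E)%E].

(* g is a version of E[f | G] *)
Definition is_cond_exp (P : probability T R) (G : set (set T)) (f g : T -> R) :=
  [/\ measurable_wrt G g, P.-integrable setT (EFin \o g)
    & forall A, G A -> (\int[P]_(w in A) (f w)%:E = \int[P]_(w in A) (g w)%:E)%E].

Definition martingale (P : probability T R) F X :=
  [/\ adapted F X,
      forall t : R, 0 <= t -> P.-integrable setT (EFin \o X t)
    & forall s t : R, 0 <= s -> s <= t -> is_cond_exp P (F s) (X t) (X s)].

Definition normal_martingale (P : probability T R) F X :=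
  martingale P F X /\ martingale P F (fun t w => (X t w - X 0 w) ^+ 2 - t).

(* Uniform convergence on compact time intervals, in probability; the event is
   {sup_(0 <= s <= t) |Z^n_s - J_s| > e}. *)
Definition ucp_cvg (P : probability T R) (Z : nat -> R -> T -> R) J :=
  forall t e : R, 0 <= t -> 0 < e ->
    P [set w | exists s : R, [/\ 0 <= s, s <= t & e < `|Z n s w - J s w|]]
      @[n --> \oo] --> 0%E.

(* H = \sum_(i < n) xi_i 1_]t_i, t_(i+1)], with xi_i F_(t_i)-measurable *)
Record elementary F := Elementary {
  el_size : nat;
  el_time : nat -> R;
  el_coef : nat -> T -> R;
  el_time_ge0 : forall i, 0 <= el_time i;
  el_time_le : forall i, el_time i <= el_time i.+1;
  el_coef_meas : forall i, (i < el_size)%N ->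
    measurable_wrt (F (el_time i)) (el_coef i)
}.

Definition el_eval F (h : elementary F) : R -> T -> R := fun t w =>
  \sum_(i < el_size h)
    el_coef h i w * \1_(`]el_time h i, el_time h i.+1]%classic) t.

Definition el_integral F (h : elementary F) X : R -> T -> R := fun t w =>
  \sum_(i < el_size h) el_coef h i w *
    (X (Num.min (el_time h i.+1) t) w - X (Num.min (el_time h i) t) w).

(* J is a version of the stochastic integral \int_0^. H_s dX_s of the adapted
   caglad process H: J is the value at H of the extension, continuous for
   dominated pointwise convergence of the integrands (to ucp convergence of
   the integrals), of the integral of elementary processes.  The adapted caglad
   processes K are locally bounded, so when X is a semimartingale the Ito
   integral satisfies this; conversely an adapted caglad H is the pointwise
   limit of a dominated sequence of elementary processes, so that J is
   determined up to indistinguishability, with J 0 = 0 almost surely. *)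
Definition is_stoch_integral (P : probability T R) F H X J :=
  [/\ adapted_pos F H, caglad H, adapted F J, cadlag J
    & forall (h : nat -> elementary F) K, adapted_pos F K -> caglad K ->
      (forall n (t : R) w, 0 < t -> `|el_eval (h n) t w| <= K t w) ->
      (forall (t : R) w, 0 < t -> el_eval (h n) t w @[n --> \oo] --> H t w) ->
      ucp_cvg P (fun n => el_integral (h n) X) J].

(* [X]_t = X_t^2 - X_0^2 - 2 \int_0^t X_(s-) dX_s *)
Definition is_quadratic_variation (P : probability T R) F X V :=
  exists2 J, is_stoch_integral P F (left_limit X) X J
    & {ae P, forall w, forall t : R, 0 <= t ->
        V t w = X t w ^+ 2 - X 0 w ^+ 2 - 2 * J t w}.

(* d[X]_t = (1 - t - X_(t-)) dX_t + dt *)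
Definition structure_equation (P : probability T R) F X :=
  exists V J, [/\ is_quadratic_variation P F X V,
    is_stoch_integral P F (fun s w => 1 - s - left_limit X s w) X J
    & {ae P, forall w, forall t : R, 0 <= t -> V t w = J t w + t}].

(* The law of tau, carried by the finite values, is an exponential law. *)
Definition exponentially_distributed (P : probability T R) (tau : T -> \bar R) :=
  exists2 r : R, 0 < r & forall A : set R, measurable A ->
    P (tau @^-1` (EFin @` A)) = exponential_prob r A.

End Processes.

(* Main.v *)
(** Write [Y = X + t].  By Abel summation the two stochastic integrals in the
   structure equation combine, pathwise and almost surely, into
   [(1 - Y_t)^2 = 1 - [X]_t + 2 \int_0^t Y_s ds] with [[X]] nondecreasing, and
   every jump of [Y] lands at 1.  Before [S0] the path is therefore continuous
   with [Y < 1]; the identity shows that it has bounded variation, so [[X]]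
   vanishes there and Gronwall gives [Y = 0], i.e. [X_t = - t].  On
   [s < S0 <= t] the same identity, started from [Y_(S0) = 1], bounds
   [|Y_t - 1|] by a deterministic quantity tending to 0 with [t - s].  Testing
   the martingale property of [X] on [{s < S0}] then yields
   [P(S0 > s) - P(S0 > t) = (t - s) P(S0 > s) + o(t - s)] uniformly, whence
   [P(S0 > t) = exp(- t)]. *)
Require Import Defs.
From HB Require Import structures.
From mathcomp Require Import all_boot all_order all_algebra.
From mathcomp Require Import all_classical all_reals all_analysis.
From mathcomp Require Import measurable_realfun.
From mathcomp Require Import ring lra.
Import Order.TTheory GRing.Theory Num.Theory.
Import numFieldNormedType.Exports.

Set Implicit Arguments.
Unset Strict Implicit.
Unset Printing Implicit Defensive.

Local Open Scope classical_set_scope.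
Local Open Scope ring_scope.

(** * Dyadic sums and one-sided limits *)

(** The integrals are only known on elementary processes and through a continuity property, so the
    pathwise argument rests on exact algebra for left-endpoint sums over dyadic partitions. The
    integrands combine because [x_- + (1 - s - x_-) = 1 - s] is deterministic and smooth: one
    summation by parts then removes the integrator. At a jump the structure equation reads
    [(dx)^2 = (1 - t - x_-) dx], hence [dx = 0] or [x_t = 1 - t]. A continuous path of bounded
    variation has zero quadratic variation, which is why bounded variation is the aim before [S0].
    The bound after [S0] is deterministic, so no conditioning at a random time occurs: on
    [{s < S0 <= t}] the value [X_t] is close to [1 - t] whatever the path did in between. *)

Section Grid.
Context {R : realType}.
Implicit Types (s t e : R) (c x : R -> R).

Definition grid (n i : nat) : R := i%:R / 2 ^+ n.

(** The [n * 2 ^ n] cells of length [1 / 2 ^ n] reach time [n], so a single index refines the mesh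
    and pushes the horizon away. *)
Definition riemann c x (n : nat) t : R :=
  \sum_(i < n * 2 ^ n)
    c (grid n i) * (x (Num.min (grid n i.+1) t) - x (Num.min (grid n i) t)).

Lemma pow2_gt0 n : 0 < 2 ^+ n :> R. Proof. exact: exprn_gt0. Qed.

Lemma grid_ge0 n i : 0 <= grid n i.
Proof. by rewrite divr_ge0 // ltW // pow2_gt0. Qed.

Lemma grid0 n : grid n 0 = 0. Proof. by rewrite /grid mul0r. Qed.

Lemma grid_le n i j : (grid n i <= grid n j) = (i <= j)%N.
Proof. by rewrite /grid ler_pM2r ?ler_nat // invr_gt0 pow2_gt0. Qed.

Lemma gridS n i : grid n i.+1 = grid n i + (2 ^+ n)^-1.
Proof. by rewrite /grid -natr1 mulrDl mul1r. Qed.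

Lemma grid_last n : grid n (n * 2 ^ n) = n%:R.
Proof. by rewrite /grid natrM natrX mulfK // gt_eqF // pow2_gt0. Qed.

Lemma grid_refine m n a : (m <= n)%N -> grid m a = grid n (a * 2 ^ (n - m)).
Proof.
move=> mn; rewrite /grid natrM natrX -{2}(subnK mn) exprD.
have h k : 2 ^+ k != 0 :> R by rewrite gt_eqF // pow2_gt0.
by field; rewrite !h.
Qed.

Lemma pow2_small e : 0 < e -> exists n0, forall n, (n0 <= n)%N -> (2 ^+ n)^-1 <= e.
Proof.
move=> e0; have [n0 _ h] := near_infty_natSinv_expn_lt (PosNum e0).
by exists n0 => n /h /=; rewrite mul1r => /ltW.
Qed.

Definition stop (n : nat) t i := Num.min (grid n i) t.

Lemma stop_0 n t : 0 <= t -> stop n t 0 = 0.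
Proof. by rewrite /stop grid0 => /min_idPl. Qed.

Lemma stop_last n t : t <= n%:R -> stop n t (n * 2 ^ n) = t.
Proof. by rewrite /stop grid_last => /min_idPr. Qed.

Lemma stop_le n t i : stop n t i <= t.
Proof. by rewrite /stop ge_min lexx orbT. Qed.

Lemma stop_ge0 n t i : 0 <= t -> 0 <= stop n t i.
Proof. by move=> t0; rewrite /stop le_min grid_ge0. Qed.

Lemma stopS n t i : stop n t i <= stop n t i.+1 <= stop n t i + (2 ^+ n)^-1.
Proof.
have h : 0 < (2 ^+ n)^-1 :> R by rewrite invr_gt0 pow2_gt0.
rewrite /stop gridS; case: (leP _ t) => ?; case: (leP _ t) => ?; lra.
Qed.

(** Beyond [t] the increment is zero, so the coefficient can be read at the stopped point; each
    summand then only involves two consecutive stopped points. *)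
Lemma stop_coef c x n t i :
  c (grid n i) * (x (stop n t i.+1) - x (stop n t i)) =
  c (stop n t i) * (x (stop n t i.+1) - x (stop n t i)).
Proof.
have [gt|/ltW tg] := leP (grid n i) t.
  by congr (c _ * _); rewrite /stop; apply/esym/min_idPl.
rewrite /stop (min_idPr tg) (min_idPr _); first by rewrite subrr !mulr0.
by apply: (le_trans tg); rewrite grid_le.
Qed.

(** Compares sums up to two times: before the partition point [s] both stopped partitions agree, and
    after it the one stopped at [s] is degenerate. *)
Lemma stop_cases n b s t i : s = grid n b -> s <= t ->
  (stop n s i = stop n t i /\ stop n s i.+1 = stop n t i.+1) \/
  [/\ stop n s i = s, stop n s i.+1 = s & s <= stop n t i].
Proof.
move=> sE st; have [ib|bi] := ltnP i b; [left|right].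
  have h j : (j <= b)%N -> stop n s j = stop n t j.
    rewrite -(grid_le n) -sE => js.
    by rewrite /stop (min_idPl js) (min_idPl (le_trans js st)).
  by split; apply: h => //; exact: ltnW.
have h j : (b <= j)%N -> stop n s j = s.
  by rewrite -(grid_le n) -sE => js; rewrite /stop; apply/min_idPr.
split; [exact: h|by apply: h; exact: leqW|].
by rewrite /stop le_min st sE grid_le bi.
Qed.

Lemma telescope_stop (f : R -> R) n t : 0 <= t -> t <= n%:R ->
  \sum_(i < n * 2 ^ n) (f (stop n t i.+1) - f (stop n t i)) = f t - f 0.
Proof.
move=> t0 tn; rewrite -(big_mkord xpredT (fun i => f (stop n t i.+1) - f (stop n t i))).
rewrite (telescope_sumr (fun i => f (stop n t i))) //.
by rewrite stop_last // stop_0.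
Qed.

Lemma riemann_sq x n t : 0 <= t -> t <= n%:R ->
  x t ^+ 2 - x 0 ^+ 2 - 2 * riemann x x n t =
  \sum_(i < n * 2 ^ n) (x (stop n t i.+1) - x (stop n t i)) ^+ 2.
Proof.
move=> t0 tn; rewrite -(telescope_stop (fun s => x s ^+ 2) t0 tn) mulr_sumr -sumrB.
by apply: eq_bigr => i _; rewrite (stop_coef x x); ring.
Qed.

(* Discrete form of [x dx + (1 - t - x) dx = (1 - t) dx = d((1 - t) x) + x dt]; the
   term [t ^+ 2 / 2] replaces [x dt] by [(x + t) dt]. *)
Lemma riemann_abel x n t : 0 <= t -> t <= n%:R ->
  riemann x x n t + riemann (fun s => 1 - s - x s) x n t
    - (1 - t) * x t + x 0 + t ^+ 2 / 2 =
  \sum_(i < n * 2 ^ n)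
    ((x (stop n t i.+1) + stop n t i.+1) * (stop n t i.+1 - stop n t i) -
     (stop n t i.+1 - stop n t i) ^+ 2 / 2).
Proof.
move=> t0 tn.
pose g s := - ((1 - s) * x s) + s ^+ 2 / 2.
have tel := telescope_stop g t0 tn.
transitivity (riemann x x n t + riemann (fun s => 1 - s - x s) x n t + (g t - g 0)).
  by rewrite /g; ring.
rewrite -tel /riemann -!big_split; apply: eq_bigr => i _ /=.
rewrite (stop_coef x x) (stop_coef (fun s => 1 - s - x s) x) /g.
by field.
Qed.

End Grid.

Section OneSided.
Context {R : realType}.
Implicit Types (s t e : R) (f g : R -> R).

Definition rcont f := forall t, 0 <= t -> f s @[s --> t^'+] --> f t.

Lemma rcont_dist f t e : rcont f -> 0 <= t -> 0 < e ->
  exists2 a, 0 < a & forall s, t <= s -> s < t + a -> `|f s - f t| <= e.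
Proof.
move=> fr t0 e0; have /cvgrPdist_le/(_ e e0) := fr t t0.
rewrite near_withinE => -[a /= a0 h]; exists a => // s.
rewrite le_eqVlt => /predU1P[<-|ts sa]; first by rewrite subrr normr0 ltW.
by rewrite distrC; apply: h => //=; rewrite ltr0_norm; lra.
Qed.

Lemma left_lim_dist f t l e : f s @[s --> t^'-] --> l -> 0 < e ->
  exists2 a, 0 < a & forall s, t - a < s -> s < t -> `|f s - l| <= e.
Proof.
move=> fl e0; have /cvgrPdist_le/(_ e e0) := fl.
rewrite near_withinE => -[a /= a0 h]; exists a => // s sa st.
by rewrite distrC; apply: h => //=; rewrite gtr0_norm; lra.
Qed.

Lemma dyadic_dense s t : 0 <= s -> s < t ->
  exists n i, s < grid n i /\ grid n i < t.
Proof.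
move=> s0 st; have [n0 /(_ n0 (leqnn _)) hn] := @pow2_small R ((t - s) / 2) ltac:(lra).
have h0 := @pow2_gt0 R n0.
have m0 : 0 <= s * 2 ^+ n0 by rewrite mulr_ge0 // ltW.
have /andP[h1 h2] := truncn_itv m0.
exists n0, (Num.truncn (s * 2 ^+ n0)).+1; split.
  by rewrite /grid ltr_pdivlMr.
rewrite gridS; apply: (@le_lt_trans _ _ (s + (t - s) / 2)); last lra.
by rewrite lerD // /grid ler_pdivrMr.
Qed.

Lemma rcont_dyadic_le f s t C : rcont f -> 0 <= s -> s < t ->
  (forall n i, s < grid n i -> grid n i < t -> f (grid n i) <= C) -> f s <= C.
Proof.
move=> fr s0 st h; apply/ler_addgt0Pr => e e0.
have [a a0 ha] := rcont_dist fr s0 e0.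
have [n [i [h1 h2]]] := @dyadic_dense s (Num.min t (s + a)) s0
  ltac:(rewrite lt_min; apply/andP; split; lra).
move: h2; rewrite lt_min => /andP[h2 h3].
have := h n i h1 h2; have := ha _ (ltW h1) h3.
by rewrite ler_norml => /andP[]; lra.
Qed.

(** A Lebesgue number argument: compactness turns a threshold on [d] that depends on the point into
    a common one. *)
Lemma compact_itv_uniform (T : R) (Q : R -> R -> Prop) :
  (forall t, 0 <= t -> t <= T -> exists2 a, 0 < a &
    forall d s, 0 < d -> d < a -> t - a < s -> s < t + a -> Q d s) ->
  exists2 d, 0 < d & forall t, 0 <= t -> t <= T -> Q d t.
Proof.
move=> h; have /compact_near_coveringP/(_ R (0^'+) Q _) := @segment_compact R 0 T.
have h' x : `[0, T]%classic x -> \forall x \near x & i \near (0:R)^'+, Q i x.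
  rewrite /= in_itv /= => /andP[x0 xT]; have [a a0 ha] := h x x0 xT.
  exists ([set y | `|x - y| < a], [set d | 0 < d < a]).
    split => /=.
      by exists a.
    by exists a => //= y /=; rewrite sub0r normrN => + y0; rewrite gtr0_norm // => ->; rewrite y0.
  move=> [y d] /= [+ /andP[d0 da]]; rewrite ltr_norml => /andP[? ?].
  by apply: ha => //; lra.
move=> /(_ h') hd.
have [d /= [d0 hQ]] : exists d : R, 0 < d /\ `[0, T]%classic `<=` Q d.
  near (0:R)^'+ => d; exists d; split => //.
  by near: d; exact: hd.
by exists d => // t t0 tT; apply: hQ; rewrite /= in_itv /= t0.
Unshelve. all: by end_near.
Qed.

End OneSided.

Section Bounded.
Context {R : realType}.
Implicit Types (s t e T : R) (x : R -> R).

Lemma cadlag_bounded x T : rcont x -> (forall t, 0 < t -> cvg (x s @[s --> t^'-])) ->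
  exists2 M, 0 <= M & forall s, 0 <= s -> s <= T -> `|x s| <= M.
Proof.
move=> xr xl.
(* The bound is written [d^-1] so that it weakens as [d] decreases, since it must hold for all small
   [d]. *)
have [|d d0 h] := @compact_itv_uniform _ T (fun d s => 0 <= s -> `|x s| <= d^-1).
  move=> t t0 tT; have [a a0 ha] := rcont_dist xr t0 ltr01.
  have [b b0 [m hb]] : exists2 b, 0 < b & exists m, forall s, 0 <= s -> t - b < s ->
      s < t -> `|x s| <= m.
    move: t0; rewrite le_eqVlt => /predU1P[<-|t0].
      by exists 1 => //; exists 0 => s s0 _; rewrite ltNge s0.
    have [b b0 hb] := left_lim_dist (xl t t0) ltr01.
    exists b => //; exists (1 + `|lim (x s @[s --> t^'-])|) => s _ sb st.
    by rewrite -lerBlDr; apply: le_trans (lerB_dist _ _) (hb _ sb st).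
  pose M := `|m| + `|x t| + 1.
  have M0 : 0 < M by rewrite /M ltr_pwDr // addr_ge0.
  exists (Num.min (Num.min a b) M^-1).
    by rewrite !lt_min a0 b0 invr_gt0.
  move=> d s d0; rewrite !lt_min => /andP[/andP[da db] dM] s1 s2 s0.
  have sb : t - b < s.
    by apply: le_lt_trans s1; rewrite lerB // !ge_min lexx orbT.
  have sa : s < t + a.
    by apply: (lt_le_trans s2); rewrite lerD2l !ge_min lexx.
  apply: (@le_trans _ _ M); last by rewrite -(invrK M) lef_pV2 ?posrE ?invr_gt0 // ltW.
  have [st|ts] := ltP s t.
    apply: (le_trans (hb s s0 sb st)); rewrite /M.
    by have := ler_norm m; have := normr_ge0 (x t); lra.
  have := ha s ts sa; have := lerB_dist (x s) (x t); rewrite /M; have := normr_ge0 m; lra.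
exists d^-1; first by rewrite invr_ge0 ltW.
by move=> s s0 sT; exact: h.
Qed.

Lemma uniform_continuity x T e : 0 < e -> rcont x ->
  (forall t, 0 < t -> t <= T -> x s @[s --> t^'-] --> x t) ->
  exists2 d, 0 < d & forall s t, 0 <= s -> s <= t -> t <= T -> t <= s + d ->
    `|x t - x s| <= e.
Proof.
move=> e0 xr xl; have e20 : 0 < e / 2 by lra.
have [|d d0 h] := @compact_itv_uniform _ T (fun d s => 0 <= s ->
    forall t, s <= t -> t <= T -> t <= s + d -> `|x t - x s| <= e).
  move=> t t0 tT; have [a a0 ha] := rcont_dist xr t0 e20.
  have [b b0 hb] : exists2 b, 0 < b & forall s, 0 <= s -> t - b < s ->
      s < t -> `|x s - x t| <= e / 2.
    move: t0; rewrite le_eqVlt => /predU1P[<-|t0].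
      by exists 1 => // s s0 _; rewrite ltNge s0.
    by have [b b0 hb] := left_lim_dist (xl t t0 tT) e20; exists b => // s _; exact: hb.
  exists (Num.min a b / 2); first by rewrite divr_gt0 // lt_min a0.
  have ma : Num.min a b <= a by rewrite ge_min lexx.
  have mb : Num.min a b <= b by rewrite ge_min lexx orbT.
  move=> d s d0 dm s1 s2 s0 r sr rT rd.
  have k q : 0 <= q -> t - b < q -> q < t + a -> `|x q - x t| <= e / 2.
    by move=> q0 q1 q2; have [?|?] := ltP q t; [exact: hb|exact: ha].
  have := ler_distD (x t) (x r) (x s).
  have := k r ltac:(lra) ltac:(lra) ltac:(lra).
  have := k s s0 ltac:(lra) ltac:(lra).
  by rewrite (distrC (x s)); lra.
exists d => // s t s0 st tT td; apply: h => //; lra.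
Qed.

End Bounded.

(** * Paths of solutions of the structure equation *)

(* [J] and [L] stand for the integrals of [x_-] and [1 - s - x_-] against [dx].
   Asking only that arbitrarily fine dyadic sums be uniformly close to them follows
   from convergence in probability, without extracting a subsequence. *)
Record good_path {R : realType} (x J L : R -> R) : Prop := GoodPath {
  gp_x0 : x 0 = 0;
  gp_rcont : rcont x;
  gp_rcontJ : rcont J;
  gp_rcontL : rcont L;
  gp_lim : forall t, 0 < t -> cvg (x s @[s --> t^'-]);
  gp_struct : forall t, 0 <= t -> x t ^+ 2 - 2 * J t = L t + t;
  gp_riemann : forall T e n0, 0 < e -> exists2 n, (n0 <= n)%N &
    forall t, 0 <= t -> t <= T -> `|riemann x x n t - J t| <= e /\
      `|riemann (fun s => 1 - s - x s) x n t - L t| <= e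
}.

(* Along a good path, [bracket L] is the quadratic variation of [x] and
   [level_integral x J L] is the primitive of [level x] vanishing at 0. *)
Definition level {R : realType} (x : R -> R) (t : R) := x t + t.
Definition bracket {R : realType} (L : R -> R) (t : R) := L t + t.
Definition level_integral {R : realType} (x J L : R -> R) (t : R) :=
  J t + L t - (1 - t) * x t + t ^+ 2 / 2.

Section Path.
Context {R : realType} {x J L : R -> R}.
Context (gp : good_path x J L).
Implicit Types (s t e : R).

Local Notation V := (bracket L).
Local Notation I := (level_integral x J L).
Local Notation y := (level x).
Let x0 : x 0 = 0 := gp_x0 gp.

Lemma path_riemann T e n0 : 0 < e -> exists n, [/\ (n0 <= n)%N, T <= n%:R,
    (2 ^+ n)^-1 <= e &
    forall t, 0 <= t -> t <= T -> `|riemann x x n t - J t| <= e /\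
      `|riemann (fun s => 1 - s - x s) x n t - L t| <= e].
Proof.
move=> e0; have [n1 h1] := pow2_small e0.
have [n hn h] := gp_riemann gp T (maxn n0 (maxn n1 (Num.truncn T).+1)) e0.
move: hn; rewrite !geq_max => /and3P[hn0 hn1 hT]; exists n; split => //.
- apply: (@le_trans _ _ (Num.truncn T).+1%:R); last by rewrite ler_nat.
  exact/ltW/truncnS_gt.
- exact: h1.
Qed.

Lemma path_identity t : 0 <= t -> y t ^+ 2 - 2 * y t + V t = 2 * I t.
Proof. by move=> t0; have := gp_struct gp t0; rewrite /level /bracket /level_integral; lra. Qed.

Lemma rcontV : rcont V.
Proof. by move=> t t0; apply: cvgD; [exact: (gp_rcontL gp)|exact: cvg_at_right_filter]. Qed.

Lemma rcontI : rcont I.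
Proof.
move=> t t0; apply: cvgD; last first.
  by apply: cvgMl; apply: cvg_at_right_filter; exact: exprn_continuous.
apply: cvgB; first by apply: cvgD; [exact: (gp_rcontJ gp)|exact: (gp_rcontL gp)].
apply: cvgM; last exact: (gp_rcont gp).
by apply: cvg_at_right_filter; apply: cvgB; [exact: cvg_cst|exact: cvg_id].
Qed.

Lemma rconty : rcont y.
Proof. by move=> t t0; apply: cvgD; [exact: (gp_rcont gp)|exact: cvg_at_right_filter]. Qed.

Lemma V0 : V 0 = 0.
Proof.
suff J0 : J 0 = 0.
  by have := gp_struct gp (lexx 0); rewrite x0 J0 /bracket; lra.
apply/eqP; rewrite -normr_eq0 eq_le normr_ge0 andbT.
apply/ler_addgt0Pr => e e0; have [n [_ _ _ h]] := @path_riemann 0 e 0 e0.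
have [+ _] := h 0 (lexx 0) (lexx 0).
rewrite /riemann big1 ?sub0r ?normrN ?add0r // => i _.
by rewrite (min_idPr (grid_ge0 _ _)) (min_idPr (grid_ge0 _ _)) subrr mulr0.
Qed.

Lemma V_approx T e n0 : 0 < e -> exists n, [/\ (n0 <= n)%N, T <= n%:R,
    (2 ^+ n)^-1 <= e & forall t, 0 <= t -> t <= T ->
    `|\sum_(i < n * 2 ^ n) (x (stop n t i.+1) - x (stop n t i)) ^+ 2 - V t| <= e].
Proof.
move=> e0; have [n [h1 h2 h3 h4]] := @path_riemann T (e / 2) n0 ltac:(lra).
exists n; split => //; first lra.
move=> t t0 tT; rewrite -riemann_sq //; last exact: le_trans tT h2.
have := gp_struct gp t0; have [+ _] := h4 t t0 tT; rewrite x0 /bracket.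
by rewrite !ler_norml => /andP[h5 h6] h7; apply/andP; split; lra.
Qed.

(** On any finer level, the sum of squares up to a dyadic time is a part of the sum up to [t]. *)
Let V_nondecreasing_dyadic m a t : grid m a <= t -> V (grid m a) <= V t.
Proof.
move=> st; have s0 : 0 <= grid m a :> R := grid_ge0 _ _.
apply/ler_addgt0Pr => e e0.
have [n [h1 h2 h3 h4]] := @V_approx t (e / 2) m ltac:(lra).
have := h4 _ s0 st; have := h4 t (le_trans s0 st) (lexx _).
have : \sum_(i < n * 2 ^ n) (x (stop n (grid m a) i.+1) - x (stop n (grid m a) i)) ^+ 2
    <= \sum_(i < n * 2 ^ n) (x (stop n t i.+1) - x (stop n t i)) ^+ 2.
  apply: ler_sum => i _.
  have [[-> ->] //|[-> -> _]] := stop_cases i (grid_refine a h1) st.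
  by rewrite subrr expr0n sqr_ge0.
by rewrite !ler_norml => h5 /andP[h6 h7] /andP[h8 h9]; lra.
Qed.

Lemma V_nondecreasing s t : 0 <= s -> s <= t -> V s <= V t.
Proof.
move=> s0; rewrite le_eqVlt => /predU1P[-> //|st].
apply: (rcont_dyadic_le rcontV s0 st) => n i _ /ltW.
exact: V_nondecreasing_dyadic.
Qed.

(** Summation by parts leaves right-endpoint sums of [y], compared with [c] cell by cell; the
    squared cell lengths are negligible. *)
Let I_increment_dyadic m a t c M : grid m a <= t ->
  (forall r, grid m a <= r -> r <= t -> `|y r - c| <= M) ->
  `|I t - I (grid m a) - c * (t - grid m a)| <= M * (t - grid m a).
Proof.
set s := grid m a => st hM; have s0 : 0 <= s := grid_ge0 _ _.
have t0 := le_trans s0 st.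
apply/ler_addgt0Pr => e e0.
(* Four errors [e / K] come from [J] and [L] at the two times, and [e / K * (t - s)] from the
   squared cell lengths. *)
pose K := 4 + (t - s).
have K0 : 0 < K by rewrite /K; lra.
have [n [h1 h2 h3 h4]] := @path_riemann t (e / K) m ltac:(exact: divr_gt0).
have at_ := riemann_abel x t0 h2; have as_ := riemann_abel x s0 (le_trans st h2).
have := telescope_stop id t0 h2; have := telescope_stop id s0 (le_trans st h2).
have [] := h4 t t0 (lexx _); have [] := h4 s s0 st.
move: at_ as_; set St := \sum_(i < _) _; set Ss := \sum_(i < _) _ => at_ as_ js ls jt lt.
set Ts := \sum_(i < _) _; set Tt := \sum_(i < _) _ => ts tt.
have : `|St - Ss - c * (Tt - Ts)| <= (M + e / K) * (Tt - Ts).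
  rewrite /St /Ss /Tt /Ts -!sumrB !mulr_sumr -sumrB.
  apply: le_trans (ler_norm_sum _ _ _) _; apply: ler_sum => i _.
  have [[-> ->]|[-> -> sp]] := stop_cases i (grid_refine a h1) st.
    by rewrite !subrr !mulr0 subrr normr0.
  have /andP[h5 h6] := stopS n t i.
  have := hM _ (le_trans sp h5) (stop_le _ _ _); rewrite /level.
  set p := stop n t i in h5 h6 sp *; set q := stop n t i.+1 in h5 h6 *.
  have d0 : 0 <= q - p by lra.
  have d1 : q - p <= e / K by lra.
  rewrite !ler_norml => /andP[h7 h8].
  by rewrite subrr mulr0 expr0n mul0r; apply/andP; split; nra.
have eK : e = e / K * 4 + e / K * (t - s).
  by rewrite -mulrDr -/K divfK // gt_eqF.
rewrite {}tt {}ts x0 in at_ as_ *.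
move: js ls jt lt; rewrite !subr0 /level_integral !ler_norml.
move=> /andP[j1 j2] /andP[l1 l2] /andP[j3 j4] /andP[l3 l4] /andP[h5 h6].
by apply/andP; split; lra.
Qed.

(** Mean value inequality for the primitive of [y]: used with [c = 0] for Lipschitz bounds and with
    [c = 1] after level one is reached. Right continuity in the lower time extends it from dyadic
    times. *)
Lemma I_increment s t c M : 0 <= s -> s <= t ->
  (forall r, s <= r -> r <= t -> `|y r - c| <= M) ->
  `|I t - I s - c * (t - s)| <= M * (t - s).
Proof.
move=> s0; rewrite le_eqVlt => /predU1P[->|st hM].
  by rewrite !subrr !mulr0 subrr normr0.
have key n i : s < grid n i -> grid n i < t ->
    `|I t - I (grid n i) - c * (t - grid n i)| <= M * (t - grid n i).
  move=> h1 h2; apply: I_increment_dyadic => [|r h3 h4]; first exact: ltW.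
  by apply: hM => //; exact: le_trans (ltW h1) h3.
have idr (k : R) : rcont (fun r => k * (t - r)).
  move=> r r0; apply: cvgM; first exact: cvg_cst.
  by apply: cvg_at_right_filter; apply: cvgB; [exact: cvg_cst|exact: cvg_id].
have cI : rcont (fun r => I t - I r).
  by move=> r r0; apply: cvgB; [exact: cvg_cst|exact: rcontI].
rewrite ler_norml; apply/andP; split.
- have := @rcont_dyadic_le _ (fun r => - (I t - I r) + (c - M) * (t - r)) s t 0 _ s0 st.
  suff h : rcont (fun r => - (I t - I r) + (c - M) * (t - r)).
    move=> /(_ h) h'; suff : - (I t - I s) + (c - M) * (t - s) <= 0 by lra.
    by apply: h' => n i h1 h2; have := key n i h1 h2; rewrite ler_norml => /andP[]; lra.
  by move=> r r0; apply: cvgD; [apply: cvgN; exact: cI|exact: idr].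
- have := @rcont_dyadic_le _ (fun r => I t - I r - (c + M) * (t - r)) s t 0 _ s0 st.
  suff h : rcont (fun r => I t - I r - (c + M) * (t - r)).
    move=> /(_ h) h'; suff : I t - I s - (c + M) * (t - s) <= 0 by lra.
    by apply: h' => n i h1 h2; have := key n i h1 h2; rewrite ler_norml => /andP[]; lra.
  by move=> r r0; apply: cvgB; [exact: cI|exact: idr].
Qed.
End Path.

(** * Jumps along a good path *)

Section Jumps.
Context {R : realType}.
Implicit Types (s t e : R) (c x : R -> R).

Lemma grid_cell n t : 0 < t -> t <= n%:R -> exists i,
  [/\ (i < n * 2 ^ n)%N, grid n i < t & t <= grid n i.+1].
Proof.
move=> t0 tn; have ex : exists k, t <= grid n k by exists (n * 2 ^ n)%N; rewrite grid_last.
case: (ex_minnP ex) => -[|i] ti mi; first by move: ti; rewrite grid0 leNgt t0.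
exists i; split => //; first by apply: mi; rewrite grid_last.
by rewrite ltNge; apply/negP => /mi; rewrite ltnn.
Qed.

(** Between two times of one cell a single summand moves; this isolates the jump at [t] with its
    coefficient. *)
Lemma riemann_cell c x n i s t : (i < n * 2 ^ n)%N ->
  grid n i <= s -> s <= t -> t <= grid n i.+1 ->
  riemann c x n t - riemann c x n s = c (grid n i) * (x t - x s).
Proof.
move=> ni is_ st ti; rewrite -sumrB (bigD1 (Ordinal ni)) //= big1 ?addr0.
  rewrite (min_idPl (le_trans is_ st)) (min_idPl is_) (min_idPr ti).
  by rewrite (min_idPr (le_trans st ti)); ring.
move=> j ji; have [jlt|jgt|jeq] := ltngtP (j : nat) i.
- have h k : (k <= i)%N -> grid n k <= s.
    by move=> ki; apply: le_trans is_; rewrite grid_le.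
  have [h1 h2] := (h j (ltnW jlt), h j.+1 jlt).
  by rewrite !(min_idPl _) ?subrr // (le_trans _ st).
- have h k : (i < k)%N -> t <= grid n k.
    by move=> ki; apply: le_trans ti _; rewrite grid_le.
  have [h1 h2] := (h j jgt, h j.+1 (leqW jgt)).
  by rewrite !(min_idPr _) ?subrr // (le_trans st).
- by move: ji; rewrite -val_eqE /= jeq eqxx.
Qed.

End Jumps.

Section PathJumps.
Context {R : realType} {x J L : R -> R}.
Context (gp : good_path x J L).
Implicit Types (s t e : R).

Local Notation V := (bracket L).
Local Notation I := (level_integral x J L).
Local Notation y := (level x).

(** With [p < s < t] in one cell, the structure equation makes [x t ^+ 2 - x s ^+ 2 - (t - s)]
    nearly [(2 * x p + 1 - p - x p) * (x t - x s)]. As [p] and [s] tend to [t], with left limit [l],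
    this becomes [x t ^+ 2 - l ^+ 2 = (1 - t + l) * (x t - l)], which factors. *)
Lemma jump_to_one t : 0 < t ->
  (x t - lim (x s @[s --> t^'-])) * (y t - 1) = 0.
Proof.
move=> t0; have xl := gp_lim gp t0.
set l := lim _ in xl *.
(* The [6] collects the Riemann errors, twice for [J] and once for [L] at each of [s] and [t]; the
   rest pays for replacing [x p] and [x s] by [l], and [p] and [s] by [t]. *)
set X := x t; pose C := 6 + (2 * `|l| + 2 + `|1 - t + l| + 2 * (`|X - l| + 1)).
have C0 : 0 < C by rewrite /C; do !(rewrite ltr_wpDr // ?addr_ge0 ?mulr_ge0 //).
suff D e : 0 < e -> e <= 1 -> `|(X - l) * (y t - 1)| <= C * e.
  apply/eqP; rewrite -normr_eq0 eq_le normr_ge0 andbT.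
  apply/ler_addgt0Pr => e e0; rewrite add0r.
  have m0 : 0 < Num.min 1 (e / C) by rewrite lt_min ltr01 divr_gt0.
  apply: (le_trans (D _ m0 _)); first by rewrite ge_min lexx.
  by rewrite mulrC -ler_pdivlMr // ge_min lexx orbT.
move=> e0 e1; have [a a0 ha] := left_lim_dist xl e0.
have ea0 : 0 < Num.min e (a / 2) by rewrite lt_min e0 divr_gt0.
have [n [_ tn hn h]] := path_riemann gp t 0 ea0.
have [i [ni it ti]] := grid_cell t0 tn.
set p := grid n i in it; pose s := (p + t) / 2.
have pge0 : 0 <= p := grid_ge0 _ _.
move: hn; rewrite le_min => /andP[hn1 hn2].
have tp : t - p <= (2 ^+ n)^-1 by move: ti; rewrite gridS -/p; lra.
have ps : p <= s by rewrite /s; lra.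
have st : s < t by rewrite /s; lra.
have hp := ha p ltac:(lra) it; have hs := ha s ltac:(lra) st.
have ee r : r <= Num.min e (a / 2) -> r <= e by move=> /le_trans; apply; rewrite ge_min lexx.
have [/ee j1 /ee l1] := h t (ltW t0) (lexx _).
have [/ee j2 /ee l2] := h s (le_trans pge0 ps) (ltW st).
have := riemann_cell x x ni ps (ltW st) ti; rewrite -/p -/X.
have := riemann_cell (fun r => 1 - r - x r) x ni ps (ltW st) ti; rewrite -/p -/X.
have := gp_struct gp (ltW t0); have := gp_struct gp (le_trans pge0 ps); rewrite -/X.
move: j1 l1 j2 l2.
set A1 := riemann _ _ _ _; set A2 := riemann _ _ _ _; set A3 := riemann _ _ _ _.
set A4 := riemann _ _ _ _.
rewrite !ler_norml => /andP[? ?] /andP[? ?] /andP[? ?] /andP[? ?] s1 s2 s3 s4.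
have : `|X ^+ 2 - x s ^+ 2 - (t - s) - (1 - p + x p) * (X - x s)| <= 6 * e.
  rewrite ler_norml (_ : _ - _ = 2 * (J t - A1) - 2 * (J s - A3) + (L t - A2) - (L s - A4)).
    by apply/andP; split; lra.
  have -> : (1 - p + x p) * (X - x s) = 2 * (A1 - A3) + (A2 - A4).
    by rewrite s3 s4; ring.
  lra.
set u := x s - l in hs *; set v := x p - l in hp *.
rewrite (_ : x s = l + u); last by rewrite /u; ring.
rewrite (_ : x p = l + v); last by rewrite /v; ring.
set E := (X in `|X| <= _) => hE.
have -> : (X - l) * (y t - 1) =
    E + (2 * l * u + u * u + (t - s) - (1 - t + l) * u + ((t - p) + v) * (X - l - u)).
  by rewrite /E /level -/X; ring.
have bnd (w z k m : R) : `|w| <= k -> `|z| <= m -> `|w * z| <= k * m.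
  by move=> ? ?; rewrite normrM ler_pM.
have uu := bnd _ _ _ _ hs (le_trans hs e1).
have lu := bnd _ _ _ _ (lexx `|2 * l|) hs.
have tu := bnd _ _ _ _ (lexx `|1 - t + l|) hs.
have ts : `|t - s| <= e by rewrite ger0_norm; lra.
have tpv : `|t - p + v| <= 2 * e.
  by apply: le_trans (ler_normD _ _) _; rewrite ger0_norm; lra.
have Xu : `|X - l - u| <= `|X - l| + 1.
  by apply: le_trans (ler_normB _ _) _; rewrite lerD2l; lra.
have pX := bnd _ _ _ _ tpv Xu.
move: uu lu tu ts pX hE; rewrite (normrM 2 l) (ger0_norm (ler0n _ 2)) /C.
rewrite !ler_norml => /andP[? ?] /andP[? ?] /andP[? ?] /andP[? ?] /andP[? ?] /andP[? ?].
by apply/andP; split; lra.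
Qed.

End PathJumps.

(** * The level before and after it reaches one *)

Section LevelOne.
Context {R : realType} {x J L : R -> R}.
Context (gp : good_path x J L).
Implicit Types (s t e : R).

Local Notation V := (bracket L).
Local Notation I := (level_integral x J L).
Local Notation y := (level x).

Lemma path_level_bounded T : exists2 M, 0 <= M &
  forall r, 0 <= r -> r <= T -> `|y r| <= M.
Proof.
apply: cadlag_bounded; first exact: rconty gp.
move=> t t0; apply: is_cvgD; first exact: (gp_lim gp).
by apply: (cvgP t); exact: cvg_at_left_filter.
Qed.

Section BeforeOne.
Context (T : R) (T0 : 0 < T).
Context (ne1 : forall r, 0 < r -> r <= T -> y r <> 1).

Lemma left_continuous_before r : 0 < r -> r <= T -> x s @[s --> r^'-] --> x r.
Proof.
move=> r0 rT; have := jump_to_one gp r0 => /eqP; rewrite mulf_eq0 => /orP[|].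
  by rewrite subr_eq0 => /eqP ->; exact: (gp_lim gp).
by rewrite subr_eq0 => /eqP /(ne1 r0 rT).
Qed.

Lemma level_continuous_before r : 0 < r -> r <= T -> {within `[0, r], continuous y}.
Proof.
move=> r0 rT; have yl q : 0 < q -> q <= T -> y s @[s --> q^'-] --> y q.
  move=> q0 qT; apply: cvgD; first exact: left_continuous_before.
  exact: cvg_at_left_filter.
apply/continuous_within_itvP => //; split.
- move=> q; rewrite in_itv /= => /andP[q0 qr]; apply/left_right_continuousP; split.
    by apply: yl => //; exact: le_trans (ltW qr) rT.
  exact: (rconty gp (ltW q0)).
- exact: (rconty gp).
- exact: yl.
Qed.

Let y0 : y 0 = 0. Proof. by rewrite /level (gp_x0 gp) addr0. Qed.

Lemma level_lt1_before r : 0 <= r -> r <= T -> y r < 1.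
Proof.
rewrite le_eqVlt => /predU1P[<- _|r0 rT]; first by rewrite y0 ltr01.
rewrite ltNge; apply/negP => yr1.
have [|q] := @IVT _ y 0 r 1 (ltW r0) (level_continuous_before r0 rT).
  by rewrite y0 ge_min ler01 /= le_max yr1 orbT.
rewrite in_itv /= => /andP[]; rewrite le_eqVlt => /predU1P[<- _|q0 qr].
  by rewrite y0 => /esym/eqP; rewrite oner_eq0.
exact: ne1 (le_trans qr rT).
Qed.

(* [(1 - y)^2 = 1 - V + 2 I] has bounded variation, hence so has [x] as
   [1 - y] stays away from 0, and [x] is continuous. *)
Lemma bracket_before : V T = 0.
Proof.
have [m + ym] := EVT_max (ltW T0) (level_continuous_before T0 (lexx _)).
rewrite in_itv /= => /andP[m0 mT].
have g0 : 0 < 1 - y m by rewrite subr_gt0 level_lt1_before.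
set g := 1 - y m in g0.
have [M M0 hM] := path_level_bounded T.
have VT0 : 0 <= V T by rewrite -(V0 gp); exact: (V_nondecreasing gp) (lexx _) (ltW T0).
(* Bounds the total variation of [x] on [[0, T]]: the quotient for [y], and [T] for the drift. The
   sum of squares is then at most [C] times the largest increment. *)
pose C := (V T + 2 * M * T) / (2 * g) + T.
have C0 : 0 < C + 1.
  rewrite ltr_wpDl // addr_ge0 ?(ltW T0) // divr_ge0 ?(mulr_ge0 _ (ltW g0)) //.
  by rewrite addr_ge0 // !mulr_ge0 // ltW.
apply/eqP; rewrite eq_le VT0 andbT; apply/ler_addgt0Pr => e e0; rewrite add0r.
have w0 : 0 < e / 2 / (C + 1) by rewrite !divr_gt0.
set w := e / 2 / (C + 1) in w0.
have [d d0 hd] := uniform_continuity w0 (gp_rcont gp) left_continuous_before.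
have ed0 : 0 < Num.min (e / 2) d by rewrite lt_min d0 divr_gt0.
have [n [_ Tn hn hV]] := V_approx gp T 0 ed0.
have {hV} := hV T (ltW T0) (lexx _).
rewrite ler_norml => /andP[]; rewrite lerNl lerBlDr opprB => + _.
have me : Num.min (e / 2) d <= e / 2 by rewrite ge_min lexx.
have md : Num.min (e / 2) d <= d by rewrite ge_min lexx orbT.
set S := \sum_(i < _) _ => hS.
suff : S <= w * C.
  have -> : e = e / 2 + w * (C + 1) by rewrite /w divfK ?gt_eqF //; field.
  by move=> h; move: hS w0; rewrite lerBlDr mulrDr; lra.
have -> : w * C = \sum_(i < n * 2 ^ n) w *
    (((V (stop n T i.+1) - V (stop n T i)) + 2 * M * (stop n T i.+1 - stop n T i)) / (2 * g)
     + (stop n T i.+1 - stop n T i)).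
  rewrite -mulr_sumr big_split /= -mulr_suml big_split /= -mulr_sumr.
  rewrite (telescope_stop V (ltW T0) Tn) (telescope_stop id (ltW T0) Tn) (V0 gp).
  by rewrite !subr0.
rewrite /S; apply: ler_sum => i _; have /andP[pq qp] := stopS n T i.
have p0 : 0 <= stop n T i by rewrite stop_ge0 // ltW.
have qT : stop n T i.+1 <= T := stop_le _ _ _.
set p := stop n T i in pq qp p0 *; set q := stop n T i.+1 in pq qp qT *.
have pT : p <= T := le_trans pq qT.
have q0 : 0 <= q := le_trans p0 pq.
have xw := hd p q p0 pq qT ltac:(lra).
have dI : `|I q - I p - 0 * (q - p)| <= M * (q - p).
  apply: (I_increment gp) => // r pr rq; rewrite subr0; apply: hM; lra.
have dV := V_nondecreasing gp p0 pq.
have := path_identity gp p0; have := path_identity gp q0 => iq ip.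
have gp2 : 2 * g <= 2 - y p - y q.
  have := ym p; have := ym q; rewrite !in_itv /= p0 q0 pT qT.
  by move=> /(_ isT) h1 /(_ isT) h2; rewrite /g; lra.
have hw : `|y q - y p| * (2 * g) <= V q - V p + 2 * M * (q - p).
  apply: (@le_trans _ _ (`|y q - y p| * (2 - y p - y q))).
    by rewrite ler_wpM2l.
  have gg : 0 <= 2 - y p - y q by apply: le_trans gp2; rewrite mulr_ge0 // ltW.
  have := normrM (y q - y p) (2 - y p - y q); rewrite (ger0_norm gg) => <-.
  (* Both sides equal [(1 - y p)^2 - (1 - y q)^2]. *)
  have -> : (y q - y p) * (2 - y p - y q) = V q - V p - 2 * (I q - I p).
    by move: iq ip; rewrite !expr2; lra.
  move: dI; rewrite mul0r subr0 !ler_norml => /andP[h1 h2].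
  by apply/andP; split; lra.
rewrite -[X in X <= _]ger0_norm ?sqr_ge0 // expr2 normrM ler_pM //.
have -> : x q - x p = (y q - y p) - (q - p) by rewrite /level; ring.
apply: le_trans (ler_normB _ _) _; rewrite (ger0_norm (_ : 0 <= q - p)) ?subr_ge0 //.
by rewrite lerD2r ler_pdivlMr // mulr_gt0.
Qed.

Lemma bracket_before_le r : 0 <= r -> r <= T -> V r = 0.
Proof.
move=> r0 rT; apply/eqP; rewrite eq_le.
by rewrite -{1}bracket_before -(V0 gp) !(V_nondecreasing gp) // ltW.
Qed.

(** Once the bracket vanishes the identity reads [y * (y - 2) = 2 * I], and [|y - 2| >= 1] below
    level one. *)
Let level_le_integral r : 0 <= r -> r <= T -> `|y r| <= 2 * `|I r|.
Proof.
move=> r0 rT; have := path_identity gp r0; rewrite (bracket_before_le r0 rT) addr0 => iy.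
have y1 := level_lt1_before r0 rT.
rewrite -(ger0_norm (ler0n R 2)) -normrM -iy.
have -> : y r ^+ 2 - 2 * y r = y r * (y r - 2) by ring.
rewrite normrM ler_peMr // ler0_norm; lra.
Qed.

(* Gronwall, in steps of length 1/4. *)
Lemma level_before r : 0 <= r -> r <= T -> y r = 0.
Proof.
have step (k : nat) : forall r, 0 <= r -> r <= T -> r <= k%:R / 4 -> y r = 0.
  elim: k => [|k IHk] {}r r0 rT rk.
    by have -> : r = 0 by apply/eqP; rewrite eq_le r0 andbT; move: rk; rewrite mul0r.
  have [M M0 hM] := path_level_bounded T.
  (* If [y] vanishes up to [k / 4] and [|y| <= B] on the next quarter, then [|I| <= B / 4] there,
     and [|y| <= 2 * |I|] halves the bound. *)
  have halve (j : nat) : forall q, 0 <= q -> q <= T -> q <= k.+1%:R / 4 ->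
      `|y q| <= M / 2 ^+ j.
    elim: j => [|j IHj] q q0 qT qk; first by rewrite expr0 divr1 hM.
    have [qk'|kq] := leP q (k%:R / 4).
      by rewrite IHk // normr0 divr_ge0 // exprn_ge0.
    have a0 : 0 <= k%:R / 4 :> R by rewrite divr_ge0.
    have aT := le_trans (ltW kq) qT.
    have Ia : I (k%:R / 4) = 0.
      have := path_identity gp a0.
      by rewrite (bracket_before_le a0 aT) IHk // expr0n /=; lra.
    apply: le_trans (level_le_integral q0 qT) _.
    have : `|I q - I (k%:R / 4) - 0 * (q - k%:R / 4)| <= M / 2 ^+ j * (q - k%:R / 4).
      apply: (I_increment gp) => //; first exact: ltW.
      move=> s h1 h2; rewrite subr0; apply: IHj.
      - exact: le_trans h1.
      - exact: le_trans h2 qT.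
      - exact: le_trans h2 qk.
    rewrite mul0r subr0 Ia subr0 => h.
    have B0 : 0 <= M / 2 ^+ j by rewrite divr_ge0 // exprn_ge0.
    have -> : M / 2 ^+ j.+1 = M / 2 ^+ j / 2.
      by rewrite exprS; field; rewrite gt_eqF // exprn_gt0.
    have : M / 2 ^+ j * (q - k%:R / 4) <= M / 2 ^+ j * (1 / 4).
      by rewrite ler_wpM2l //; move: qk; rewrite -natr1; lra.
    lra.
  apply/eqP; rewrite -normr_eq0 eq_le normr_ge0 andbT.
  apply/ler_addgt0Pr => e e0; rewrite add0r.
  have [n /(_ n (leqnn _)) hn] := @pow2_small R (e / (M + 1)) ltac:(rewrite divr_gt0 //; lra).
  apply: le_trans (halve n r r0 rT rk) _.
  apply: le_trans (_ : (M + 1) * (e / (M + 1)) <= _); last by rewrite mulrC divfK // gt_eqF //; lra.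
  by apply: ler_pM => //; lra.
move=> r0 rT; apply: (step (Num.truncn (4 * r)).+1) => //.
by have := truncnS_gt (4 * r); lra.
Qed.
End BeforeOne.

(** With [u] the supremum of [|y - 1|] on [[s, t]], the identity and the monotone bracket give
    [u ^+ 2 <= 2 * (t - s) * (1 + u)]; as [u ^+ 2 / (1 + u)] increases with [u], this excludes
    [u > e]. *)
Lemma level_after s t e : 0 <= s -> s <= t -> y s = 1 ->
  0 < e -> 2 * (t - s) * (1 + e) < e ^+ 2 -> `|y t - 1| <= e.
Proof.
move=> s0 st ys e0 he.
have [M M0 hM] := path_level_bounded t.
pose E := [set `|y r - 1| | r in `[s, t]%classic].
have inE r : s <= r -> r <= t -> E `|y r - 1|.
  by move=> ? ?; exists r => //=; rewrite in_itv /=; apply/andP.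
have Eub : ubound E (M + 1).
  move=> _ [r /= + <-]; rewrite in_itv /= => /andP[sr rt].
  apply: le_trans (ler_normB _ _) _; rewrite normr1 lerD2r hM //.
  exact: le_trans sr.
have hu r : s <= r -> r <= t -> `|y r - 1| <= sup E.
  by move=> sr rt; apply: ub_le_sup; [exists (M + 1)|exact: inE].
set u := sup E in hu.
have u0 : 0 <= u by apply: le_trans (hu s (lexx _) st).
apply: le_trans (hu t st (lexx _)) _.
rewrite leNgt; apply/negP => eu.
have hh : u <= Num.sqrt (2 * (t - s) * (1 + u)).
  apply: ge_sup; first by exists `|y s - 1|; exact: inE.
  move=> _ [r /= + <-]; rewrite in_itv /= => /andP[sr rt].
  rewrite -sqrtr_sqr ler_wsqrtr //.
  have r0 := le_trans s0 sr.
  have := path_identity gp s0; have := path_identity gp r0; rewrite ys expr1n.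
  have := V_nondecreasing gp s0 sr.
  have : `|I r - I s - 1 * (r - s)| <= u * (r - s).
    apply: (I_increment gp) => // q sq qr; apply: hu => //; exact: le_trans qr rt.
  rewrite ler_norml => /andP[_ h1] h2 h3 h4.
  have -> : (y r - 1) ^+ 2 = y r ^+ 2 - 2 * y r + 1 by ring.
  have : (r - s) * (1 + u) <= (t - s) * (1 + u) by apply: ler_wpM2r; lra.
  lra.
have : u ^+ 2 <= 2 * (t - s) * (1 + u).
  have h0 : 0 <= 2 * (t - s) * (1 + u) by rewrite !mulr_ge0 //; lra.
  by rewrite -(sqr_sqrtr h0) ler_sqr // nnegrE ?sqrtr_ge0.
rewrite -(ler_pM2r (_ : 0 < 1 + e)); last lra.
move: he; rewrite -(ltr_pM2r (_ : 0 < 1 + u)); last lra.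
(* The product equals [u ^+ 2 * (1 + e) - e ^+ 2 * (1 + u)]. *)
have : 0 < (u - e) * (u + e + u * e).
  by rewrite mulr_gt0 // ?subr_gt0 //; have := mulr_ge0 u0 (ltW e0); lra.
by rewrite !expr2; lra.
Qed.

End LevelOne.

(** * The hitting time of level one, path by path *)

Definition hit_one {R : realType} (x : R -> R) : \bar R :=
  ereal_inf [set t%:E | t in [set t : R | 0 < t /\ x t + t = 1]].

Section HitOne.
Context {R : realType} {x J L : R -> R}.
Context (gp : good_path x J L).
Implicit Types (s t e h : R).

Lemma hit_one_le t : 0 < t -> level x t = 1 -> (hit_one x <= t%:E)%E.
Proof. by move=> t0 yt; apply: ereal_inf_lbound; exists t. Qed.

Lemma lt_hit_one s t : s < t -> (forall r : R, 0 < r -> r < t -> level x r <> 1) ->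
  (s%:E < hit_one x)%E.
Proof.
move=> st h; apply: (@lt_le_trans _ _ t%:E); first by rewrite lte_fin.
apply: le_ereal_inf_tmp => _ [r [r0 yr] <-]; rewrite lee_fin leNgt.
by apply/negP => rt; exact: h yr.
Qed.

(** Makes the event [t < hit_one x] depend on the path up to [t] only. Conversely, from level 0 at
    time [t], right continuity keeps the level away from 1 a little longer. *)
Lemma lt_hit_oneP t : 0 <= t ->
  (t%:E < hit_one x)%E <-> (forall s : R, 0 <= s -> s <= t -> x s = - s).
Proof.
move=> t0; split=> [th s s0 st|h].
  have [s_gt0|] := ltP 0 s; last first.
    move=> s_le0; have sE : s = 0 by apply/eqP; rewrite eq_le s_le0.
    by rewrite sE (gp_x0 gp) oppr0.
  suff : level x s = 0 by rewrite /level; lra.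
  have T0 : 0 < t := lt_le_trans s_gt0 st.
  apply: (level_before gp T0) => // r r0 rt yr.
  by have := lt_le_trans th (hit_one_le r0 yr); rewrite lte_fin ltNge rt.
have [a a0 ha] := rcont_dist (rconty gp) t0 (ltac:(lra) : 0 < 1 / 2).
apply: (@lt_hit_one t (t + a)); first lra.
move=> r r0 ra yr; have yt : level x t = 0 by rewrite /level h //; lra.
have [rt|tr] := ltP r t; first by move: yr; rewrite /level (h r) ?ltW //; lra.
by have := ha r tr ra; rewrite yr yt subr0 normr1; lra.
Qed.

Lemma hit_one_gt0 : (0 < hit_one x)%E.
Proof.
apply/(lt_hit_oneP (lexx 0)) => s s0 s0'.
have -> : s = 0 by apply/eqP; rewrite eq_le s0 andbT.
by rewrite (gp_x0 gp) oppr0.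
Qed.

(** Were the level at [s] not 1, right continuity would keep it off 1 slightly beyond [s], and the
    infimum would be larger. *)
Lemma hit_one_level s : hit_one x = s%:E -> 0 < s /\ level x s = 1.
Proof.
move=> hs; have s0 : 0 < s by rewrite -lte_fin -hs hit_one_gt0.
split => //; apply: contrapT => ys.
have d0 : 0 < `|1 - level x s| / 2.
  by rewrite divr_gt0 // normr_gt0 subr_eq0 eq_sym; apply/eqP.
have [a a0 ha] := rcont_dist (rconty gp) (ltW s0) d0.
suff : (s%:E < hit_one x)%E by rewrite hs ltxx.
apply: (@lt_hit_one s (s + a)); first lra.
move=> r r0 ra yr; have [rs|sr] := ltP r s.
  by have := hit_one_le r0 yr; rewrite hs lee_fin leNgt rs.
by have := ha r sr ra; rewrite yr; move: d0; lra.
Qed.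

Lemma level_after_hit s t e : 0 <= s -> (s%:E < hit_one x)%E -> (hit_one x <= t%:E)%E ->
  0 < e -> 2 * (t - s) * (1 + e) < e ^+ 2 -> `|x t + t - 1| <= e.
Proof.
move=> s0 sh ht e0 he; move: (hit_one_level) sh ht.
case: (hit_one x) => [u|//|//] /(_ u erefl) [u0 yu].
rewrite lte_fin lee_fin => su ut; apply: (level_after gp (ltW u0) ut yu e0).
apply: le_lt_trans he; rewrite ler_pM2r ?ler_pM2l //; lra.
Qed.

End HitOne.

(** * Passage to almost every path *)

Section SigmaAlgebra.
Context {R : realType} {d : measure_display} {T : measurableType d}.
Implicit Types (G : set (set T)) (f : T -> R) (Z : R -> T -> R).

Lemma measurable_wrt_ray G f : sigma_algebra setT G ->
  (forall a, G [set w | a < f w]) -> measurable_wrt G f.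
Proof.
move=> sG h B mB.
have mf : measurable_fun setT (f : g_sigma_algebraType G -> R).
  apply: (measurability _ (RGenOInfty.measurableE R)) => _ [_ [a ->] <-].
  rewrite setTI measurable_g_measurableTypeE //.
  by rewrite set_itvoy; exact: h.
by have := mf measurableT B mB; rewrite setTI measurable_g_measurableTypeE.
Qed.

(** Gives access, for adapted processes, to the closure properties of measurable functions. *)
Lemma measurable_wrtP G f : sigma_algebra setT G ->
  measurable_wrt G f <-> measurable_fun setT (f : g_sigma_algebraType G -> R).
Proof.
move=> sG; split=> [h _ B mB|mf B mB].
  by rewrite setTI measurable_g_measurableTypeE //; exact: h.
by have := mf measurableT B mB; rewrite setTI measurable_g_measurableTypeE.
Qed.

Lemma measurable_wrt_ray_preimage G f a : measurable_wrt G f -> G [set w | a < f w].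
Proof.
move=> h; have := h `]a, +oo[%classic (measurable_itv _).
by congr (G _); apply/seteqP; split => w /=; rewrite in_itv /= andbT.
Qed.

(** By right continuity a strict excess at [s] persists just after [s], so dyadic times suffice; the
    strict [s < t] leaves room for them. *)
Lemma exceed_dyadic Z t a : (forall w, rcont (Z^~ w)) ->
  [set w | exists s, [/\ 0 <= s, s < t & a < `|Z s w|]] =
  \bigcup_n \bigcup_i
    (if grid n i < t then [set w | a < `|Z (grid n i) w|] else set0).
Proof.
move=> Zr; apply/seteqP; split=> w /=.
  move=> [s [s0 st sa]]; have e0 : 0 < (`|Z s w| - a) / 2 by lra.
  have [b b0 hb] := rcont_dist (Zr w) s0 e0.
  have [|n [i [h1 h2]]] := @dyadic_dense R s (Num.min t (s + b)) s0.
    by rewrite lt_min st; lra.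
  exists n => //; exists i => //.
  move: h2; rewrite lt_min => /andP[h2 h3]; rewrite h2 /=.
  have := hb _ (ltW h1) h3; rewrite distrC => h4.
  have := le_trans (lerB_dist _ _) h4; lra.
move=> [n _ [i _]]; case: ifPn => // h1 h2.
by exists (grid n i); split => //; exact: grid_ge0.
Qed.

Lemma measurable_exceed G Z t a : sigma_algebra setT G -> (forall w, rcont (Z^~ w)) ->
  (forall s, 0 <= s -> s < t -> measurable_wrt G (Z s)) ->
  G [set w | exists s, [/\ 0 <= s, s < t & a < `|Z s w|]].
Proof.
move=> sG Zr mZ; rewrite exceed_dyadic // -(measurable_g_measurableTypeE sG).
apply: bigcupT_measurable => n; apply: bigcupT_measurable => i.
case: ifPn => [it|_]; last exact: measurable0.
rewrite measurable_g_measurableTypeE //; apply: measurable_wrt_ray_preimage.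
apply/measurable_wrtP => //; apply: measurableT_comp => //.
by apply/measurable_wrtP => //; apply: mZ => //; exact: grid_ge0.
Qed.

(* The running supremum over [0, t[ : it dominates every left-endpoint
   discretization of Z, and is adapted and caglad. *)
Definition running_sup Z : R -> T -> R := fun t w =>
  sup [set `|Z s w| | s in [set s | 0 <= s < t]].

Section RunningSup.
Context (Z : R -> T -> R) (Z_cadlag : cadlag Z).

Let Zr w : rcont (Z^~ w). Proof. by case: (Z_cadlag w). Qed.

Let bounded t w : exists2 M, 0 <= M &
  ubound [set `|Z s w| | s in [set s | 0 <= s < t]] M.
Proof.
have [_ Zl] := Z_cadlag w.
have [M M0 hM] := cadlag_bounded t (@Zr w) Zl.
by exists M => // _ [s /= /andP[s0 st] <-]; rewrite hM // ltW.
Qed.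

Lemma le_running_sup s t w : 0 <= s -> s < t -> `|Z s w| <= running_sup Z t w.
Proof.
move=> s0 st; have [M _ hM] := bounded t w.
by apply: ub_le_sup; [exists M|exists s => //=; rewrite s0].
Qed.

Lemma lt_running_sup a t w : 0 < t ->
  a < running_sup Z t w <-> exists s, [/\ 0 <= s, s < t & a < `|Z s w|].
Proof.
move=> t0; split=> [/sup_gt|[s [s0 st sa]]].
  case; first by exists `|Z 0 w|, 0 => //=; rewrite lexx.
  by move=> _ [s /= /andP[s0 st] <-] sa; exists s.
exact: lt_le_trans sa (le_running_sup _ s0 st).
Qed.

Lemma running_sup_ge0 t w : 0 < t -> 0 <= running_sup Z t w.
Proof. by move=> t0; apply: le_trans (le_running_sup w (lexx 0) t0). Qed.

Lemma running_sup_nondecreasing s t w : 0 < s -> s <= t ->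
  running_sup Z s w <= running_sup Z t w.
Proof.
move=> s0 st; rewrite leNgt; apply/negP => /(lt_running_sup _ _ s0)[r [r0 rs]].
by rewrite ltNge le_running_sup // (lt_le_trans rs).
Qed.

Lemma running_sup_caglad : caglad (running_sup Z).
Proof.
move=> w; split=> t t0.
  apply/cvgrPdist_le => e e0.
  (* The supremum over [[0, t[] is nearly reached at some [r < t], hence by every running supremum
     taken at a time in []r, t]]. *)
  have /(lt_running_sup _ _ t0)[r [r0 rt hr]] : running_sup Z t w - e < running_sup Z t w.
    by lra.
  near=> s; have rs : r < s by near: s; exact: nbhs_left_gt.
  have st : s <= t by near: s; exact: nbhs_left_le.
  have h1 := running_sup_nondecreasing w (le_lt_trans r0 rs) st.
  have h2 := le_running_sup w r0 rs.
  by rewrite ger0_norm; lra.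
apply: nondecreasing_at_right_is_cvgr.
  near=> b => r s; rewrite !in_itv /= => /andP[tr _] _ rs.
  by apply: running_sup_nondecreasing => //; exact: le_lt_trans tr.
near=> b; exists 0 => _ [r /= + <-]; rewrite in_itv /= => /andP[tr _].
by apply: running_sup_ge0; exact: le_lt_trans tr.
Unshelve. all: by end_near.
Qed.

Lemma running_sup_adapted F : filtration F -> adapted F Z -> adapted_pos F (running_sup Z).
Proof.
move=> [sF _ homoF] aZ t t0; apply: measurable_wrt_ray; first exact: sF (ltW t0).
move=> a; rewrite (_ : [set w | _] = [set w | exists s, [/\ 0 <= s, s < t & a < `|Z s w|]]).
  apply: measurable_exceed => //; first exact: sF (ltW t0).
  by move=> s s0 st B mB; apply: (homoF s t s0 (ltW st)); exact: aZ.
by apply/seteqP; split => w /= /(lt_running_sup _ _ t0).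
Qed.

End RunningSup.
End SigmaAlgebra.

(** * Riemann sums as integrals of elementary processes *)

Section RiemannRegularity.
Context {R : realType}.
Implicit Types (c x : R -> R).

Lemma rcont_cst (k : R) : rcont (fun=> k).
Proof. by move=> t _; exact: cvg_cst. Qed.

Lemma rcont_minr x g : rcont x -> rcont (fun s => x (Num.min g s)).
Proof.
move=> xr t t0; have [gt|tg] := leP g t.
  apply: cvg_near_cst; near=> s.
  by rewrite min_l // (le_trans gt) //; near: s; exact: nbhs_right_ge.
apply: cvg_trans (xr t t0); apply: near_eq_cvg; near=> s.
by rewrite min_r //; near: s; exact: nbhs_right_le.
Unshelve. all: by end_near.
Qed.

Lemma rcont_sum (N : nat) (f : nat -> R -> R) : (forall i, rcont (f i)) ->
  rcont (fun s => \sum_(i < N) f i s).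
Proof.
move=> fr; elim: N => [|N IHN].
  under eq_fun do rewrite big_ord0; exact: rcont_cst.
under eq_fun do rewrite big_ord_recr /=.
by move=> t t0; apply: cvgD; [exact: IHN|exact: fr].
Qed.

Lemma rcont_riemann c x n : rcont x -> rcont (riemann c x n).
Proof.
move=> xr; apply: (@rcont_sum _ (fun i s => c (grid n i) *
  (x (Num.min (grid n i.+1) s) - x (Num.min (grid n i) s)))) => i t t0.
apply: cvgM; first exact: cvg_cst.
by apply: cvgB; exact: rcont_minr.
Qed.

End RiemannRegularity.

Section DyadicElementary.
Context {R : realType} {d : measure_display} {T : measurableType d}.
Implicit Types (F : R -> set (set T)) (H J X Z : R -> T -> R).

Definition dyadic_elementary F Z (Z_adapted : adapted F Z) (n : nat) : elementary F :=
  @Elementary R d T F (n * 2 ^ n) (grid n) (fun i => Z (grid n i))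
    (grid_ge0 n) (fun i => etrans (grid_le n i i.+1) (leqnSn i))
    (fun i _ => Z_adapted _ (grid_ge0 n i)).

Lemma el_eval_dyadic F Z (aZ : adapted F Z) n t w i : (i < n * 2 ^ n)%N ->
  grid n i < t -> t <= grid n i.+1 ->
  el_eval (dyadic_elementary aZ n) t w = Z (grid n i) w.
Proof.
move=> ni it ti; rewrite /el_eval /= (bigD1 (Ordinal ni)) //= big1 ?addr0.
  by rewrite indicE mem_set ?mulr1 //= in_itv /= it.
move=> j ji; rewrite indicE memNset ?mulr0 //= in_itv /= => /andP[h1 h2].
have [jlt|jgt|jeq] := ltngtP (j : nat) i.
- suff : t <= grid n i by rewrite leNgt it.
  by apply: (le_trans h2); rewrite grid_le.
- suff : t <= grid n j by rewrite leNgt h1.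
  by apply: (le_trans ti); rewrite grid_le.
- by move: ji; rewrite -val_eqE /= jeq eqxx.
Qed.

Lemma el_eval_dyadic_out F Z (aZ : adapted F Z) n t w : n%:R < t ->
  el_eval (dyadic_elementary aZ n) t w = 0.
Proof.
move=> nt; rewrite /el_eval big1 // => j _.
rewrite indicE memNset ?mulr0 //= in_itv /= => /andP[_ h2].
have : t <= n%:R by rewrite -grid_last; apply: (le_trans h2); rewrite grid_le.
by rewrite leNgt nt.
Qed.

(** The left-endpoint discretizations of [Z] converge pointwise to its left limit [H] and are
    dominated by [running_sup Z]; their elementary integrals are the Riemann sums by computation. *)
Lemma ucp_riemann (P : probability T R) F H X J Z : filtration F ->
  cadlag Z -> adapted F Z ->
  (forall w t, 0 < t -> Z s w @[s --> t^'-] --> H t w) ->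
  is_stoch_integral P F H X J ->
  ucp_cvg P (fun n t w => riemann (Z^~ w) (X^~ w) n t) J.
Proof.
move=> fF cZ aZ ZH [_ _ _ _ /(_ (dyadic_elementary aZ) (running_sup Z))]; apply.
- exact: running_sup_adapted.
- exact: running_sup_caglad.
- move=> n t w t0; have [tn|nt] := leP t n%:R.
    have [i [ni it ti]] := grid_cell t0 tn.
    rewrite (el_eval_dyadic aZ w ni it ti).
    exact: (le_running_sup cZ w (grid_ge0 n i) it).
  by rewrite el_eval_dyadic_out // normr0; exact: running_sup_ge0.
- move=> t w t0; apply/cvgrPdist_le => e e0.
  have [a a0 ha] := left_lim_dist (ZH w t t0) e0.
  have [n0 hn0] := @pow2_small R (a / 2) ltac:(lra).
  exists (maxn n0 (Num.truncn t).+1) => // n; rewrite /= geq_max => /andP[h1 h2].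
  have tn : t <= n%:R.
    by apply/ltW; apply: lt_le_trans (truncnS_gt t) _; rewrite ler_nat.
  have [i [ni it ti]] := grid_cell t0 tn.
  rewrite (el_eval_dyadic aZ w ni it ti) distrC; apply: ha => //.
  have := hn0 n h1; move: ti; rewrite gridS; lra.
Qed.

Lemma adapted_measurable F Z t : filtration F -> adapted F Z -> 0 <= t ->
  measurable_fun setT (Z t).
Proof.
by move=> [_ Fm _] aZ t0 _ B mB; rewrite setTI; apply: (Fm t t0); exact: aZ.
Qed.

Lemma measurable_sup_exceed Z t e : 0 <= t -> (forall w, rcont (Z^~ w)) ->
  (forall s, 0 <= s -> measurable_fun setT (Z s)) ->
  measurable [set w | exists s : R, [/\ 0 <= s, s <= t & e < `|Z s w|]].
Proof.
move=> t0 Zr mZ.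
rewrite (_ : [set w | _] = [set w | exists s : R, [/\ 0 <= s, s < t & e < `|Z s w|]] `|`
    [set w | e < `|Z t w|]).
  apply: measurableU.
    apply: measurable_exceed => //; first exact: sigma_algebra_measurable.
    by move=> s s0 _ B mB; rewrite -[X in measurable X]setTI; exact: mZ.
  apply: measurable_wrt_ray_preimage => B mB; rewrite -[X in measurable X]setTI.
  by apply: measurableT_comp (mB) => //; exact: mZ.
apply/seteqP; split => w /=.
  move=> [s [s0 + se]]; rewrite le_eqVlt => /predU1P[<-|st]; first by right.
  by left; exists s.
by move=> [[s [s0 /ltW st se]]|te]; [exists s|exists t].
Qed.

Lemma measurable_riemann F X Z n t : filtration F -> adapted F X -> adapted F Z ->
  0 <= t -> measurable_fun setT (fun w => riemann (Z^~ w) (X^~ w) n t).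
Proof.
move=> fF aX aZ t0; apply: measurable_sum => i.
have h s : 0 <= s -> measurable_fun setT (X s).
  by move=> s0; exact: (adapted_measurable fF aX s0).
apply: measurable_funM; first exact: (adapted_measurable fF aZ (grid_ge0 n i)).
by apply: measurable_funB; apply: h; rewrite le_min grid_ge0.
Qed.

(** For every large [n] the event lies in the union of [A n] and [B n], of probability at most
    [P (A n) + P (B n)]. Treating both sequences together yields one index that serves both. *)
Lemma ucp_never_close (P : probability T R) (A B : nat -> set T) n0 :
  (forall n, measurable (A n)) -> (forall n, measurable (B n)) ->
  P (A n) @[n --> \oo] --> 0%E -> P (B n) @[n --> \oo] --> 0%E ->
  P.-negligible [set w | forall n, (n0 <= n)%N -> A n w \/ B n w].
Proof.
move=> mA mB A0 B0.
have mD : measurable (\bigcap_(n in [set n | (n0 <= n)%N]) (A n `|` B n)).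
  by apply: bigcap_measurable => [|n _]; [exists n0 => /=|exact: measurableU].
exists (\bigcap_(n in [set n | (n0 <= n)%N]) (A n `|` B n)); split => //.
apply/eqP; rewrite -measure_le0.
have AB0 : (P (A n) + P (B n))%E @[n --> \oo] --> 0%E.
  by rewrite -[0%E]adde0; apply: cvgeD.
rewrite -(cvg_lim _ AB0) //; apply: lime_ge; first by apply/cvg_ex; exists 0%E.
exists n0 => // n /= hn; apply: le_trans (measureU2 _ (mA n) (mB n)).
by apply: le_measure; rewrite ?inE //; [exact: measurableU|move=> w; exact].
Qed.

End DyadicElementary.

Section AlmostSurePaths.
Context {R : realType} {d : measure_display} {T : measurableType d}.
Implicit Types (F : R -> set (set T)) (X : R -> T -> R).

Lemma ae_good_path (P : probability T R) F X :
  filtration F -> adapted F X -> cadlag X -> {ae P, forall w, X 0 w = 0} ->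
  structure_equation P F X ->
  exists J L, {ae P, forall w, good_path (X^~ w) (J^~ w) (L^~ w)}.
Proof.
move=> fF aX cX X0 [V [L [[J sJ VJ] sL VL]]]; exists J, L.
have [_ _ aJ cJ _] := sJ; have [_ _ aL cL _] := sL.
pose Z s w := 1 - s - X s w.
have cZ : cadlag Z.
  move=> w; have [Xr Xl] := cX w; split => t t0.
    apply: cvgB; last exact: Xr.
    by apply: cvgB; [exact: cvg_cst|exact: cvg_at_right_filter].
  apply: is_cvgB; last exact: Xl.
  by apply/cvg_ex; exists (1 - t); apply: cvgB; [exact: cvg_cst|exact: cvg_at_left_filter].
have aZ : adapted F Z.
  move=> t t0; have [sF _ _] := fF.
  apply/(measurable_wrtP _ (sF t t0)); apply: measurable_funB => //.
  by apply/(measurable_wrtP _ (sF t t0)); exact: aX.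
have uJ := ucp_riemann fF cX aX (fun w t t0 => (cX w).2 t t0) sJ.
have uL : ucp_cvg P (fun n t w => riemann (Z^~ w) (X^~ w) n t) L.
  apply: (ucp_riemann fF cZ aZ _ sL) => w t t0.
  apply: cvgB; last exact: ((cX w).2 t t0).
  by apply: cvgB; [exact: cvg_cst|exact: cvg_at_left_filter].
have mE A Y n t e : adapted F A -> cadlag Y -> adapted F Y -> 0 <= t -> 0 < e ->
    measurable [set w | exists s : R, [/\ 0 <= s, s <= t &
      e < `|riemann (A^~ w) (X^~ w) n s - Y s w|]].
  move=> aA cY aY t0 e0.
  apply: (@measurable_sup_exceed _ _ _
    (fun s w => riemann (A^~ w) (X^~ w) n s - Y s w)) => // [w s s0|s s0].
    apply: cvgB; last exact: (cY w).1.
    by apply: rcont_riemann => //; exact: (cX w).1.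
  apply: measurable_funB; last exact: (adapted_measurable fF aY s0).
  exact: (measurable_riemann _ fF aX aA s0).
(* Paths for which no level from [n0] on is accurate for both integrals; integer horizons,
   tolerances [1 / (k + 1)] and all [n0] make countably many such events. *)
pose bad (t e : R) n0 := [set w | forall n, (n0 <= n)%N ->
  (exists s : R, [/\ 0 <= s, s <= t & e < `|riemann (X^~ w) (X^~ w) n s - J s w|]) \/
  (exists s : R, [/\ 0 <= s, s <= t & e < `|riemann (Z^~ w) (X^~ w) n s - L s w|])].
have badN (t e : R) n0 : 0 <= t -> 0 < e -> P.-negligible (bad t e n0).
  move=> t0 e0; apply: ucp_never_close (uJ t e t0 e0) (uL t e t0 e0) => n;
    exact: mE.
have badU : P.-negligible
    (\bigcup_m \bigcup_k \bigcup_n0 bad m%:R (k.+1%:R)^-1 n0).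
  do 3 apply: negligible_bigcup => ?.
  by apply: badN; rewrite ?ler0n // invr_gt0 ltr0n.
have good : {ae P, forall w, forall m k n0, ~ bad m%:R (k.+1%:R)^-1 n0 w}.
  apply: negligibleS badU => w /= /existsNP[m /existsNP[k /existsNP[n0 /contrapT h]]].
  by exists m => //; exists k => //; exists n0.
apply: filterS3 good (filterI VJ VL) X0 => w gw [hVJ hVL] x0.
split => //.
- by move=> t t0; exact: (cX w).1.
- by move=> t t0; exact: (cJ w).1.
- by move=> t t0; exact: (cL w).1.
- by move=> t t0; exact: (cX w).2.
- move=> t t0; have := hVJ t t0; rewrite (hVL t t0) x0; lra.
move=> t e n0 e0; have [k hk] : exists k : nat, (k.+1%:R)^-1 <= e.
  exists (Num.truncn e^-1); rewrite -[X in _ <= X]invrK lef_pV2 ?posrE ?invr_gt0 ?ltr0n //.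
  exact/ltW/truncnS_gt.
have /existsNP[n /not_implyP[n0n /not_orP[hJ hL]]] := gw (Num.truncn t).+1 k n0.
exists n => // s s0 st.
have sT : s <= (Num.truncn t).+1%:R by apply: (le_trans st); exact/ltW/truncnS_gt.
split; apply: le_trans hk; rewrite leNgt; apply/negP => h.
- by apply: hJ; exists s.
- by apply: hL; exists s.
Qed.

End AlmostSurePaths.

(** * The law of the hitting time *)

Section ExponentialTail.
Context {R : realType}.
Implicit Types (G : R -> R) (s t e : R).

Lemma expRN_second_order (h : R) : 0 <= h -> 1 - h <= expR (- h) <= 1 - h + h ^+ 2.
Proof.
move=> h0; rewrite (le_trans (expR_ge1Dx (- h))) //= expRN.
have h1 : 0 < 1 + h by lra.
apply: (@le_trans _ _ (1 + h)^-1); first by rewrite lef_pV2 ?posrE ?expR_gt0 ?expR_ge1Dx.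
by rewrite -[leLHS]mul1r ler_pdivrMr //; nra.
Qed.

(** An Euler scheme for [G' = - G]: over a step [h], [G (s + h)] is [(1 - h) * G s] up to
    [2 * e * h], and errors do not grow since [expR (- h) <= 1]. *)
Lemma exponential_tail G : G 0 = 1 -> (forall t, 0 <= t -> 0 <= G t <= 1) ->
  (forall s t, 0 <= s -> s <= t -> G t <= G s) ->
  (forall s t e, 0 <= s -> s <= t -> 0 < e -> 2 * (t - s) * (1 + e) < e ^+ 2 ->
    `|(t - s) * G s - (G s - G t)| <= e * (G s - G t)) ->
  forall t, 0 <= t -> G t = expR (- t).
Proof.
move=> G0 G01 Gni inc t; rewrite le_eqVlt => /predU1P[<-|t0].
  by rewrite oppr0 expR0.
suff D e : 0 < e -> e <= 1 / 2 -> `|G t - expR (- t)| <= 3 * t * e.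
  apply/eqP; rewrite -subr_eq0 -normr_eq0 eq_le normr_ge0 andbT.
  apply/ler_addgt0Pr => e e0; rewrite add0r.
  have m0 : 0 < Num.min (1 / 2) (e / (3 * t)) by rewrite lt_min !divr_gt0 // mulr_gt0.
  apply: (le_trans (D _ m0 _)); first by rewrite ge_min lexx.
  by rewrite mulrC -ler_pdivlMr ?mulr_gt0 // ge_min lexx orbT.
move=> e0 e1.
(* For [e <= 1 / 2], a step [h <= e ^+ 2 / 4] meets the condition of the hypothesis and is at most
   [e], so the [n] local errors [h * (h + 2 * e)] add up to at most [3 * t * e]. *)
have [n [n0 hn]] : exists n : nat, 0 < n%:R :> R /\ t / n%:R <= e ^+ 2 / 4.
  have q0 : 0 < e ^+ 2 / 4 by rewrite divr_gt0 // exprn_gt0.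
  exists (Num.truncn (t / (e ^+ 2 / 4))).+1; split; first by rewrite ltr0n.
  by rewrite ler_pdivrMr ?ltr0n // mulrC -ler_pdivrMr //; exact/ltW/truncnS_gt.
set h := t / n%:R in hn.
have h0 : 0 < h by rewrite divr_gt0.
have he : h <= e by nra.
have hh : 2 * h * (1 + e) < e ^+ 2.
  by rewrite !expr2 in hn *; have := mulr_gt0 e0 e0; nra.
have step s : 0 <= s -> `|G (s + h) - expR (- h) * G s| <= h * (h + 2 * e).
  move=> s0; have sh : s <= s + h by lra.
  have := inc s (s + h) e s0 sh e0; rewrite [s + h - s]addrAC subrr add0r => /(_ hh).
  have : 0 <= G s - G (s + h) by rewrite subr_ge0 Gni.
  have /andP[G1 G2] := G01 _ s0.
  have /andP[E1 E2] := expRN_second_order (ltW h0).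
  set p := G s - G (s + h) => p0; rewrite !ler_norml => /andP[h1 h2].
  (* Indeed [(1 - e) * p <= h * G s <= h], with [e <= 1 / 2]. *)
  have p2 : p <= 2 * h by nra.
  have -> : G (s + h) = G s - p by rewrite /p; ring.
  have ep : e * p <= e * (2 * h) by rewrite ler_pM2l.
  have hG : 0 <= (expR (- h) - 1 + h) * G s <= h ^+ 2.
    by apply/andP; split; nra.
  move/andP: hG => [hG1 hG2]; rewrite expr2 in hG2.
  by apply/andP; split; lra.
have iter (k : nat) : `|G (k%:R * h) - expR (- (k%:R * h))| <= k%:R * (h * (h + 2 * e)).
  elim: k => [|k IHk]; first by rewrite !mul0r oppr0 expR0 G0 subrr normr0.
  have k0 : 0 <= k%:R * h by rewrite mulr_ge0 // ltW.
  have -> : k.+1%:R * h = k%:R * h + h by rewrite -natr1 mulrDl mul1r.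
  have := step _ k0; rewrite opprD expRD.
  have /andP[E1 E2] := expRN_second_order (ltW h0).
  have E3 : expR (- h) <= 1 by rewrite expR_le1; lra.
  have E0 := expR_gt0 (- h).
  move: IHk; set a := G (k%:R * h); set b := expR (- (k%:R * h)); set c := expR (- h) in E3 E0 *.
  move=> IHk st.
  have -> : G (k%:R * h + h) - b * c = (G (k%:R * h + h) - c * a) + c * (a - b) by ring.
  apply: le_trans (ler_normD _ _) _; rewrite normrM (gtr0_norm E0) -natr1.
  have : c * `|a - b| <= 1 * `|a - b| by rewrite ler_wpM2r.
  lra.
have := iter n; rewrite {1 2}/h mulrC divfK ?gt_eqF // => /le_trans; apply.
rewrite mulrA (mulrC n%:R) {1}/h divfK ?gt_eqF //.
have := ltW t0; nra.
Qed.

End ExponentialTail.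

Lemma measure_setD_null {R : realType} {d : measure_display} {T : measurableType d}
    (P : probability T R) (D N : set T) :
  measurable D -> measurable N -> P N = 0%E -> P (D `\` N) = P D.
Proof.
move=> mD mN N0; transitivity (P D - P (D `&` N))%E.
  by apply: measureD => //; rewrite (le_lt_trans (probability_le1 P mD)) ?ltry.
suff -> : P (D `&` N) = 0%E by rewrite sube0.
by apply/eqP; rewrite -measure_le0 -N0 le_measure ?inE //; exact: measurableI.
Qed.

(** * Testing the martingale on survival events *)

Section HittingTime.
Context {R : realType} {d : measure_display} {T : measurableType d}.
Context (P : probability T R) (F : R -> set (set T)) (X J L : R -> T -> R).
Context (fF : filtration F) (uF : usual_conditions P F).
Context (mX : martingale P F X) (cX : cadlag X).
Context (gX : {ae P, forall w, good_path (X^~ w) (J^~ w) (L^~ w)}).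

Let S w := hit_one (X^~ w).

Lemma usual_modification t (A B : set T) : 0 <= t -> F t A ->
  P.-negligible (A `\` B) -> P.-negligible (B `\` A) -> F t B.
Proof.
move=> t0 FA AB BA; have [sF _ homoF] := fF; have [_ nF] := uF.
have h N : P.-negligible N -> F t N by move=> /nF; exact: homoF.
have -> : B = (A `\` (A `\` B)) `|` (B `\` A).
  apply/seteqP; split=> w /=.
    by move=> Bw; have [Aw|Aw] := pselect (A w); [left; split => // -[]|right].
  by move=> [[Aw AB']|[]//]; apply: contrapT => Bw; apply: AB'.
rewrite -(measurable_g_measurableTypeE (sF t t0)).
have mF N : F t N -> (F t).-sigma.-measurable N.
  by rewrite measurable_g_measurableTypeE //; exact: sF.
by apply: measurableU; [apply: measurableD|]; apply: mF => //; exact: h.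
Qed.

(** On good paths [S <= t] exactly when [Y] is nonzero somewhere on [[0, t]], an event of [F t] by
    right continuity; the other paths form a null set, absorbed by [usual_modification]. *)
Lemma hitting_stopping_time : stopping_time F S.
Proof.
move=> t t0; have [sF _ homoF] := fF; have [aX _ _] := mX.
pose Y s w := X s w + s.
have aY s : 0 <= s -> measurable_wrt (F s) (Y s).
  move=> s0; apply/(measurable_wrtP _ (sF s s0)); apply: measurable_funD => //.
  by apply/(measurable_wrtP _ (sF s s0)); exact: aX.
pose A := [set w | exists s, [/\ 0 <= s, s < t & 0 < `|Y s w|]] `|` [set w | 0 < `|Y t w|].
have FA : F t A.
  rewrite -(measurable_g_measurableTypeE (sF t t0)); apply: measurableU;
    rewrite measurable_g_measurableTypeE; try exact: sF.
    apply: measurable_exceed; first exact: sF.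
      by move=> w s s0; apply: cvgD; [exact: (cX w).1|exact: cvg_at_right_filter].
    by move=> s s0 st B mB; apply: (homoF s t s0 (ltW st)); exact: aY.
  apply: measurable_wrt_ray_preimage; apply/(measurable_wrtP _ (sF t t0)).
  by apply: measurableT_comp => //; apply/(measurable_wrtP _ (sF t t0)); exact: aY.
have AE w : good_path (X^~ w) (J^~ w) (L^~ w) -> A w <-> (S w <= t%:E)%E.
  move=> g; rewrite leNgt; split.
    move=> Aw; apply/negP => /(lt_hit_oneP g t0) h.
    case: Aw => [[s [s0 st]]|] /=; rewrite /Y h ?addNr ?normr0 ?ltxx //; exact: ltW.
  move=> /negP tS; apply: contrapT => /not_orP[A1 A2]; apply: tS.
  apply/(lt_hit_oneP g t0) => s s0; rewrite le_eqVlt => /predU1P[->|st].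
    apply/eqP; rewrite -addr_eq0; apply: contrapT => /negP; rewrite -normr_gt0.
    exact: A2.
  apply/eqP; rewrite -addr_eq0; apply: contrapT => /negP; rewrite -normr_gt0 => h.
  by apply: A1; exists s.
apply: (usual_modification t0 FA); apply: negligibleS gX => w /= [h1 h2];
  by move=> /AE [h3 h4]; auto.
Qed.

Let tail s := [set w | (s%:E < S w)%E].

Lemma tail_filtration s : 0 <= s -> F s (tail s).
Proof.
move=> s0; have [sF _ _] := fF.
rewrite -(measurable_g_measurableTypeE (sF s s0)).
rewrite (_ : tail s = ~` [set w | (S w <= s%:E)%E]).
  apply: measurableC; rewrite measurable_g_measurableTypeE; last exact: sF.
  exact: hitting_stopping_time.
by apply/seteqP; split => w /=; rewrite /tail /= ltNge => /negP.
Qed.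

Lemma measurable_tail s : 0 <= s -> measurable (tail s).
Proof. by move=> s0; have [_ Fm _] := fF; apply: (Fm s s0); exact: tail_filtration. Qed.

Lemma integral_between (D N : set T) (f : T -> R) (a b : R) :
  measurable D -> measurable N -> P N = 0%E ->
  P.-integrable setT (EFin \o f) -> (forall w, D w -> ~ N w -> a <= f w <= b) ->
  a * fine (P D) <= fine (\int[P]_(w in D) (f w)%:E) <= b * fine (P D).
Proof.
move=> mD mN N0 If h.
have mDN : measurable (D `\` N) by exact: measurableD.
have ID : P.-integrable D (EFin \o f) by exact: integrableS If.
have IDN : P.-integrable (D `\` N) (EFin \o f) by exact: integrableS If.
have PDN : P D = P (D `\` N) by rewrite (measure_setD_null mD mN N0).
have fin : P (D `\` N) \is a fin_num by exact: fin_num_measure.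
have cst_int (k : R) : (\int[P]_(w in D `\` N) k%:E = (k * fine (P (D `\` N)))%:E)%E.
  by rewrite EFinM fineK // -integral_cst.
have fI := integrable_fin_num mDN IDN.
rewrite (negligible_integral mN mD ID N0) PDN.
rewrite -2!lee_fin fineK // -!cst_int; apply/andP; split; apply: le_integral => //.
- exact: finite_measure_integrable_cst.
- by move=> w /set_mem[Dw Nw]; rewrite lee_fin; have /andP[] := h w Dw Nw.
- exact: finite_measure_integrable_cst.
- by move=> w /set_mem[Dw Nw]; rewrite lee_fin; have /andP[] := h w Dw Nw.
Qed.

Let G s := fine (P (tail s)).

(** On [{S > s}] the martingale property equates [- s * G s] with the integral of [X t]: the part
    [{S > t}] gives [- t * G t], and the rest [(1 - t) * (G s - G t)] up to [e * (G s - G t)]. *)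
Lemma tail_increment s t e : 0 <= s -> s <= t -> 0 < e ->
  2 * (t - s) * (1 + e) < e ^+ 2 ->
  `|(t - s) * G s - (G s - G t)| <= e * (G s - G t).
Proof.
move=> s0 st e0 he; have t0 := le_trans s0 st.
have [_ IX /(_ s t s0 st)[_ _ /(_ _ (tail_filtration s0)) mart]] := mX.
have [N [mN N0 gN]] := gX.
have good w : ~ N w -> good_path (X^~ w) (J^~ w) (L^~ w).
  by move=> Nw; apply: contrapT => h; apply: Nw; exact: gN.
have mAs := measurable_tail s0; have mAt := measurable_tail t0.
have ts : tail t `<=` tail s.
  by move=> w; rewrite /tail /=; apply: le_lt_trans; rewrite lee_fin.
have mB : measurable (tail s `\` tail t) by exact: measurableD.
have PB : fine (P (tail s `\` tail t)) = G s - G t.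
  rewrite measureD ?(le_lt_trans (probability_le1 P mAs)) ?ltry //.
  by rewrite setIidr // fineB // fin_num_measure.
have h1 : - s * G s <= fine (\int[P]_(w in tail s) (X s w)%:E) <= - s * G s.
  apply: (integral_between mAs mN N0 (IX s s0)) => w sw /good g.
  by have /(lt_hit_oneP g s0)/(_ s s0 (lexx s)) -> := sw; rewrite lexx.
have h2 : - t * G t <= fine (\int[P]_(w in tail t) (X t w)%:E) <= - t * G t.
  apply: (integral_between mAt mN N0 (IX t t0)) => w tw /good g.
  by have /(lt_hit_oneP g t0)/(_ t t0 (lexx t)) -> := tw; rewrite lexx.
have h3 : (1 - t - e) * (G s - G t) <=
    fine (\int[P]_(w in tail s `\` tail t) (X t w)%:E) <= (1 - t + e) * (G s - G t).
  rewrite -PB; apply: (integral_between mB mN N0 (IX t t0)) => w [sw /negP].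
  rewrite -leNgt => wt /good g.
  have := level_after_hit g s0 sw wt e0 he.
  by rewrite ler_norml => /andP[? ?]; apply/andP; split; lra.
have split_int : fine (\int[P]_(w in tail s) (X t w)%:E) =
    fine (\int[P]_(w in tail t) (X t w)%:E) +
    fine (\int[P]_(w in tail s `\` tail t) (X t w)%:E).
  have It D : measurable D -> P.-integrable D (EFin \o X t).
    by move=> mD; exact: integrableS (IX t t0).
  rewrite -fineD; [|exact: (integrable_fin_num mAt (It _ mAt))
                   |exact: (integrable_fin_num mB (It _ mB))].
  rewrite -integral_setU //.
  - by rewrite setDUK.
  - by rewrite setDUK //; have /integrableP[] := It _ mAs.
  - by apply/disj_setPS => w [? []].
rewrite -mart in h1; move/andP: h1 => [h11 h12]; move/andP: h2 => [h21 h22].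
by move/andP: h3 => [h31 h32]; rewrite ler_norml; apply/andP; split; lra.
Qed.

Lemma hitting_time_tail t : 0 <= t -> P (tail t) = (expR (- t))%:E.
Proof.
move=> t0.
have fin s : 0 <= s -> P (tail s) \is a fin_num.
  by move=> s0; apply: fin_num_measure; exact: (measurable_tail s0).
rewrite -[LHS]fineK ?fin //; congr (_%:E); apply: (@exponential_tail R G) => //.
- have m0 := measurable_tail (lexx 0).
  have : P (~` tail 0) = 0%E.
    apply: measure_negligible; first exact: measurableC.
    by apply: negligibleS gX => w /= h g; apply: h; exact: (hit_one_gt0 g).
  rewrite probability_setC // /G; move: (fin _ (lexx 0)).
  by case: (P (tail 0)) => // r _ [/eqP]; rewrite subr_eq0 => /eqP <-.
- move=> s s0; rewrite -!lee_fin fineK ?fin //.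
  by rewrite measure_ge0 probability_le1 //; exact: (measurable_tail s0).
- move=> s r s0 sr; have r0 := le_trans s0 sr.
  rewrite -lee_fin !fineK ?fin //; apply: le_measure.
  + by rewrite inE; exact: (measurable_tail r0).
  + by rewrite inE; exact: (measurable_tail s0).
  + by move=> w; rewrite /tail /=; apply: le_lt_trans; rewrite lee_fin.
- exact: tail_increment.
Qed.

End HittingTime.

(** * From the exponential tail to the law and the mean *)

Section ExponentialLaw.
Context {R : realType}.

(* The canonical instance takes a proof of [0 < rate], which unification cannot find. *)
Let expo : probability (measurableTypeR R) R :=
  exponential_distribution_exponential_prob__canonical__probability_measure_Probability
    (@ltr01 R).

Lemma exponential_prob_itvNyo0 : exponential_prob 1 `]-oo, (0 : R)[ = 0%E.
Proof.
apply: integral0_eq => x /=; rewrite in_itv /= => x0.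
by rewrite lt0_exponential_pdf.
Qed.

Lemma exponential_prob_itvcc (x : R) : 0 <= x ->
  exponential_prob 1 `[0, x] = (1 - (expR (- x))%:E)%E.
Proof.
rewrite le_eqVlt => /predU1P[<-|x0].
  by rewrite set_itv1 /exponential_prob integral_set1 oppr0 expR0 subee.
by rewrite exponential_prob_itv0c // mulN1r.
Qed.

Lemma exponential_prob_itvoy (x : R) : 0 <= x ->
  exponential_prob 1 `]x, +oo[ = (expR (- x))%:E.
Proof.
move=> x0; have : expo `]-oo, x]%classic = (1 - (expR (- x))%:E)%E.
  rewrite -exponential_prob_itvcc //.
  rewrite (_ : `]-oo, x]%classic = `[0, x]%classic `|` `]-oo, 0[%classic).
    exact: (@measureU0 _ _ _ expo `[0, x]%classic `]-oo, 0[%classic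
      (measurable_itv _) (measurable_itv _) exponential_prob_itvNyo0).
  apply/seteqP; split=> y /=; rewrite !in_itv /=.
    by case: (leP 0 y) => _ yx; [left|right].
  by move=> [/andP[]//|y0]; exact: le_trans (ltW y0) x0.
move=> h; rewrite -setCitvl.
have -> : exponential_prob 1 (~` `]-oo, x]) = expo (~` `]-oo, x]%classic) by [].
by rewrite probability_setC // h -!EFinB subKr.
Qed.

Lemma exponential_prob_itvoy_lt0 (x : R) : x < 0 -> exponential_prob 1 `]x, +oo[ = 1%E.
Proof.
move=> x0; have h : expo `]-oo, x]%classic = 0%E.
  apply: integral0_eq => y /=; rewrite in_itv /= => yx.
  by rewrite lt0_exponential_pdf // (le_lt_trans yx).
rewrite -setCitvl; have -> : exponential_prob 1 (~` `]-oo, x]) = expo (~` `]-oo, x]%classic) by [].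
by rewrite probability_setC // h sube0.
Qed.

Context {d : measure_display} {T : measurableType d} (P : probability T R).
Context (S : T -> \bar R) (S_ge0 : forall w, (0 <= S w)%E).
Context (mtail : forall t : R, 0 <= t -> measurable [set w | (t%:E < S w)%E]).
Context (Ptail : forall t : R, 0 <= t -> P [set w | (t%:E < S w)%E] = (expR (- t))%:E).

Let mS : measurable_fun setT S.
Proof.
apply: (measurability _ (ErealGenOInfty.measurableE R)) => _ [_ [x ->] <-].
rewrite setTI set_itvoy; have [x0|x0] := leP 0 x; first exact: mtail.
rewrite (_ : _ @^-1` _ = setT) //; apply/seteqP; split => // w _ /=.
by apply: lt_le_trans (S_ge0 w); rewrite lte_fin.
Qed.

Let mf : measurable_fun setT (fine \o S).
Proof. by apply: measurableT_comp => //; exact: fine_measurable. Qed.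

(** [fine] sends [+oo] to 0, a default that is harmless because [never] is null. *)
Let f : {mfun T >-> R} := mfun_Sub (mem_set mf).

Let never := [set w | S w = +oo%E].

Let mnever : measurable never.
Proof. by have := mS measurableT (emeasurable_set1 +oo%E); rewrite setTI. Qed.

(** For every [e > 0] the event lies in [{S > 1 / e}], of probability [exp (- 1 / e) <= e]. *)
Let Pnever : P never = 0%E.
Proof.
apply/eqP; rewrite -measure_le0; apply/lee_addgt0Pr => e e0; rewrite add0e.
have i0 : 0 <= e^-1 by rewrite invr_ge0 ltW.
apply: (@le_trans _ _ (expR (- e^-1))%:E); last first.
  rewrite lee_fin expRN -[leRHS]invrK lef_pV2 ?posrE ?expR_gt0 ?invr_gt0 //.
  by apply: le_trans (expR_ge1Dx _); rewrite lerDr.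
rewrite -Ptail //; apply: le_measure; rewrite ?inE //.
  exact: mtail.
by move=> w /= ->; rewrite ltry.
Qed.

Let fin_S w : ~ never w -> S w = (fine (S w))%:E.
Proof. by rewrite /never /=; have := S_ge0 w; case: (S w) => // _ /(_ erefl). Qed.

Let tail_finite (t : R) : 0 <= t ->
  P (f @^-1` `]t, +oo[) = (expR (- t))%:E.
Proof.
move=> t0; rewrite -Ptail // -(measure_setD_null (mtail t0) mnever Pnever).
congr (P _); apply/seteqP; split => w /=; rewrite in_itv /= andbT /never /=.
  move=> h; have Sw : S w <> +oo%E by move=> Sw; move: h; rewrite Sw /= ltNge t0.
  by split => //; rewrite (fin_S Sw) lte_fin.
by move=> [+ Sw]; rewrite {1}(fin_S Sw) lte_fin.
Qed.

(** Open rays form a pi-system generating the Borel sets, and both laws agree on them; a ray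
    starting below 0 has full mass. *)
Lemma law_of_exponential_tail (A : set R) : measurable A ->
  P (f @^-1` A) = exponential_prob 1 A.
Proof.
move=> mA.
have mg : @measurable_fun _ _ T (measurableTypeR R) setT (fine \o S) by exact: mf.
pose g : {mfun T >-> measurableTypeR R} :=
  @mfun_Sub _ _ T (measurableTypeR R) (fine \o S) (mem_set mg).
apply: (@measure_unique _ R (measurableTypeR R) (@RGenOInfty.G R)
  (fun n => `](- n%:R), +oo[%classic) _ _ _ _ (distribution P g) expo) => //.
- exact: RGenOInfty.measurableE.
- move=> _ _ [a ->] [b ->]; exists (Num.max a b).
  by apply/seteqP; split => y /=; rewrite !in_itv /= !andbT gt_max => /andP.
- by move=> n; exists (- n%:R).
- apply/seteqP; split => // y _; exists (Num.truncn (- y)).+1 => //=.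
  by rewrite in_itv /= andbT ltrNl truncnS_gt.
- move=> _ [a ->]; have [a0|a0] := leP 0 a.
    by apply: etrans (tail_finite a0) _; rewrite -exponential_prob_itvoy.
  apply: etrans _ (esym (exponential_prob_itvoy_lt0 a0)).
  rewrite -(probability_setT P); congr (P _); apply/seteqP; split => // w _ /=.
  rewrite in_itv /= andbT; apply: (lt_le_trans a0).
  exact: fine_ge0.
- move=> n; apply: le_lt_trans (probability_le1 (distribution P g) _) _ => //.
  exact: ltry.
Qed.

Lemma exponential_of_tail : exponentially_distributed P S.
Proof.
exists 1 => // A mA; rewrite -law_of_exponential_tail //.
have mfA : measurable (f @^-1` A) by have := mf measurableT mA; rewrite setTI.
rewrite -(measure_setD_null mfA mnever Pnever).
congr (P _); apply/seteqP; split => w /=.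
  by rewrite /never /= => -[a Aa <-]; split.
by move=> [Aw Sw]; exists (fine (S w)) => //; rewrite -fin_S.
Qed.

(** The mean of a nonnegative variable is the integral of its tail, and [exp (- t)] is also the
    density of the exponential law of rate 1, of total mass 1. *)
Lemma integral_of_exponential_tail : (\int[P]_w S w = 1)%E.
Proof.
transitivity (\int[P]_w (f w)%:E)%E.
  apply: ge0_ae_eq_integral => //.
  - by apply/measurable_EFinP.
  - by move=> w _; rewrite lee_fin fine_ge0.
  - by exists never; split => // w /= /not_implyP[_ h]; apply: contrapT => /fin_S.
rewrite -expectation_def ge0_expectation_ccdf; last by move=> w; exact: fine_ge0.
rewrite -(integral_exponential_pdf (@ltr01 R)) integral_mkcond.
apply: eq_integral => t _; rewrite /exponential_pdf !patchE.
case: ifPn => // /set_mem /=; rewrite in_itv /= andbT => t0.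
by rewrite /ccdf; apply: etrans (tail_finite t0) _; rewrite mul1r mulN1r.
Qed.

End ExponentialLaw.

Theorem proposition4p1 (R : realType) (d : measure_display)
    (Omega : measurableType d) (P : probability Omega R)
    (F : R -> set (set Omega)) (X : R -> Omega -> R)
    (F_filtration : filtration F)
    (F_generates : generates_measurable F)
    (F_usual : usual_conditions P F)
    (X_normal : normal_martingale P F X)
    (X_cadlag : cadlag X)
    (X_init : {ae P, forall w, X 0 w = 0})
    (X_structure : structure_equation P F X) :
  let Y := fun (t : R) (w : Omega) => X t w + t in
  let S0 := fun w : Omega =>
    ereal_inf [set t%:E | t in [set t : R | 0 < t /\ Y t w = 1]] in
  [/\ stopping_time F S0, exponentially_distributed P S0
    & (\int[P]_w S0 w = 1)%E].
Proof.
move=> Y S0; have [X_mart _] := X_normal; have [X_adapted _ _] := X_mart.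
have [J [L good]] := ae_good_path F_filtration X_adapted X_cadlag X_init X_structure.
have S0_ge0 w : (0 <= S0 w)%E.
  by apply: le_ereal_inf_tmp => _ [t [t0 _] <-]; rewrite lee_fin ltW.
have mtail := measurable_tail F_filtration F_usual X_mart X_cadlag good.
have Ptail := hitting_time_tail F_filtration F_usual X_mart X_cadlag good.
split.
- exact: (hitting_stopping_time F_filtration F_usual X_mart X_cadlag good).
- exact: (exponential_of_tail S0_ge0 mtail Ptail).
- exact: (integral_of_exponential_tail S0_ge0 mtail Ptail).
Qed.
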